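(* The following categories are isomorphic: (i) The category of $\infty$-algebras, i.e. of $\infty$-categories and $\infty$-functors internal to the category $\mathsf{Alg}$ of algebras. (ii) The category of $\infty$-groupoids internal to $\mathsf{Alg}$ (and $\infty$-functors between them). (iii) The full subcategory of the category of globular algebras whose objects are the globular algebras $A$ that satisfy, for all $n$-cells $a$ and $b$ of $A$, the relations $$ab = a s_0(b) + t_0(a) b - t_0(a) s_0(b) = s_0(a) b + a t_0(b) - s_0(a) t_0(b).$$ (iv) The full subcategory of the category of globular bimodules whose objects are the pairs $(A,M)$ such that $M_0$ is equal to $A$, with its canonical $A$-bimodule structure, and that satisfy, for all $n$-cells $a$ and $b$ of $M$, the relation $$a s_0(b) + t_0(a) b - t_0(a) s_0(b) = s_0(a) b + a t_0(b) - s_0(a) t_0(b).$$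
   Context: Fix a field $\mathbb{K}$. Algebras are unital associative $\mathbb{K}$-algebras, and $\mathsf{Alg}$ is their category. Let $\mathcal{C}$ be $\mathsf{Alg}$, or the category of bimodules over an algebra. A globular object $X$ of $\mathcal{C}$ is a sequence $(X_n)_{n\ge0}$ of objects of $\mathcal{C}$ with morphisms $s,t:X_{n+1}\to X_n$ and $i:X_n\to X_{n+1}$ such that $ss=st$, $ts=tt$, $si=ti=\mathrm{id}$. Elements of $X_n$ are called $n$-cells, and $i(x)$ is written $1_x$, or just $x$ (iterated identities are omitted from the notation). A globular morphism is a sequence of morphisms $X_n\to Y_n$ commuting with $s,t,i$. For $n\ge k$, $s_k,t_k:X_n\to X_k$ denote the iterated source and target maps (the identity if $n=k$). Globular algebras are the globular objects of $\mathsf{Alg}$. A globular $A$-bimodule is a globular object in $A$-bimodules. A globular bimodule is a pair $(A,M)$ with $A$ an algebra and $M$ a globular $A$-bimodule; a morphism $(A,M)\to(B,N)$ is a pair $(F,G)$ with $F:A\to B$ a morphism of algebras and $G=(G_n:M_n\to N_n)_{n\ge0}$ linear, commuting with $s,t,i$, and such that $G(ama')=F(a)G(m)F(a')$ for $a,a'\in A$, $m\in M$. If $M_0=A$, then for an $n$-cell $a$ of $M$ the $0$-cells $s_0(a),t_0(a)$ are elements of $A$; thus $a s_0(b)$, $t_0(a)b$, etc. use the bimodule structure of $M_n$, and $t_0(a)s_0(b)$ and $s_0(a)t_0(b)$ are seen in $M_n$ through iterated identities. An $\infty$-category of $\mathsf{Alg}$ is a globular algebra $X$ with, for all $0\le k<n$,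 a composition $(x,y)\mapsto x\star_k y$ from the algebra $X_n\star_k X_n=\{(x,y)\in X_n\times X_n : t_k(x)=s_k(y)\}$ (with componentwise operations) to $X_n$, which is a morphism of algebras, satisfying the usual axioms of strict $\infty$-categories: $s(x\star_k y)=s(x)$ and $t(x\star_k y)=t(y)$ if $k=n-1$, $s(x\star_k y)=s(x)\star_k s(y)$ and $t(x\star_k y)=t(x)\star_k t(y)$ otherwise; $1_{x\star_k y}=1_x\star_k 1_y$; associativity of $\star_k$; $s_k(x)\star_k x=x=x\star_k t_k(x)$; and the exchange relation $(x\star_k x')\star_j(y\star_k y')=(x\star_j y)\star_k(x'\star_j y')$ for $j<k$ whenever defined. An $\infty$-functor is a globular morphism of globular algebras commuting with all compositions. An $\infty$-groupoid of $\mathsf{Alg}$ is an $\infty$-category of $\mathsf{Alg}$ in which every $n$-cell $x$, $n\ge1$, is invertible: there is an $n$-cell $x^-$ with source $t(x)$ and target $s(x)$ such that $x\star_{n-1}x^-=s(x)$ and $x^-\star_{n-1}x=t(x)$.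
   Formalization: In (iv), morphisms (F,G) are additionally required to satisfy G_0 = F under the identification M_0 = A; for the literal full subcategory the claim fails, since (id,0) is an endomorphism of every (A,M), whereas K has only one endomorphism in (iii). *)

(* Defs.v *)
From HB Require Import structures.
From mathcomp Require Import all_boot all_order all_algebra.
From mathcomp Require Import boolp.
Set Implicit Arguments.
Unset Strict Implicit.
Unset Printing Implicit Defensive.
Import GRing.Theory.
Local Open Scope ring_scope.

(** * Categories *)

Record category := Category {
  obj :> Type;
  hom : obj -> obj -> Type;
  idc : forall X, hom X X;
  compc : forall X Y Z, hom Y Z -> hom X Y -> hom X Z;
  compcA : forall X Y Z T (h : hom Z T) (g : hom Y Z) (f : hom X Y),
    compc h (compc g f) = compc (compc h g) f;
  comp1c : forall X Y (f : hom X Y), compc (idc Y) f = f;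
  compc1 : forall X Y (f : hom X Y), compc f (idc X) = f }.

Arguments idc {c} X.

Record functor (C D : category) := Functor {
  fobj :> C -> D;
  fhom : forall X Y : C, hom X Y -> hom (fobj X) (fobj Y);
  fhom1 : forall X, fhom (idc X) = idc (fobj X);
  fhomM : forall X Y Z (g : hom Y Z) (f : hom X Y),
    fhom (compc g f) = compc (fhom g) (fhom f) }.

Definition functor_id (C : category) : functor C C :=
  @Functor C C id (fun _ _ f => f) (fun _ => erefl) (fun _ _ _ _ _ => erefl).

Lemma functor_comp1 (C D E : category) (G : functor D E) (F : functor C D) X :
  fhom G (fhom F (idc X)) = idc (G (F X)).
Proof. by rewrite !fhom1. Qed.

Lemma functor_compM (C D E : category) (G : functor D E) (F : functor C D)
    X Y Z (g : hom Y Z) (f : hom X Y) :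
  fhom G (fhom F (compc g f)) =
  compc (fhom G (fhom F g)) (fhom G (fhom F f)).
Proof. by rewrite !fhomM. Qed.

Definition functor_comp (C D E : category) (G : functor D E) (F : functor C D) :
    functor C E :=
  @Functor C E (fun X => G (F X)) (fun _ _ f => fhom G (fhom F f))
    (functor_comp1 G F) (@functor_compM _ _ _ G F).

(* Isomorphism, not mere equivalence: the composites are equal to the identity
   functors. *)
Definition isomorphic (C D : category) : Prop :=
  exists (F : functor C D) (G : functor D C),
    functor_comp G F = functor_id C /\ functor_comp F G = functor_id D.

(* Objects with additional structure, and all morphisms of the underlying
   objects. *)
Definition induced_cat (C : category) (T : Type) (U : T -> C) : category :=
  @Category T (fun X Y => hom (U X) (U Y)) (fun X => idc (U X))
    (fun _ _ _ g f => compc g f)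
    (fun _ _ _ _ => @compcA C _ _ _ _) (fun _ _ => @comp1c C _ _)
    (fun _ _ => @compc1 C _ _).

Definition full_subcat (C : category) (P : C -> Prop) : category :=
  induced_cat (@sval C P).

Section Subcategory.
Variables (C : category) (Q : forall X Y : C, hom X Y -> Prop).
Hypothesis Q1 : forall X, Q (idc X).
Hypothesis QM : forall X Y Z (g : hom Y Z) (f : hom X Y),
  Q g -> Q f -> Q (compc g f).

Let whom (X Y : C) := {f : hom X Y | Q f}.
Let widc (X : C) : whom X X := exist _ (idc X) (Q1 X).
Let wcompc X Y Z (g : whom Y Z) (f : whom X Y) : whom X Z :=
  exist _ (compc (sval g) (sval f)) (QM (svalP g) (svalP f)).

Lemma whom_eq X Y (f g : whom X Y) : sval f = sval g -> f = g.
Proof.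
by case: f g => [f Pf] [g Pg] /= e; case: _ / e Pg => Pg; rewrite (Prop_irrelevance Pf Pg).
Qed.

Definition wide_subcat : category.
Proof.
refine (@Category C whom widc wcompc _ _ _) => *; apply: whom_eq => /=.
- exact: compcA.
- exact: comp1c.
- exact: compc1.
Defined.
End Subcategory.

(** * Globular objects *)

Section Globular.
Variable C : category.

Record globular := Globular {
  cell :> nat -> C;
  src : forall n, hom (cell n.+1) (cell n);
  tgt : forall n, hom (cell n.+1) (cell n);
  idt : forall n, hom (cell n) (cell n.+1);
  globular_ss : forall n, compc (src n) (src n.+1) = compc (src n) (tgt n.+1);
  globular_ts : forall n, compc (tgt n) (src n.+1) = compc (tgt n) (tgt n.+1);
  globular_si : forall n, compc (src n) (idt n) = idc (cell n);
  globular_ti : forall n, compc (tgt n) (idt n) = idc (cell n) }.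

Record globular_hom (X Y : globular) := GlobularHom {
  ghom :> forall n, hom (X n) (Y n);
  ghom_src : forall n, compc (ghom n) (src X n) = compc (src Y n) (ghom n.+1);
  ghom_tgt : forall n, compc (ghom n) (tgt X n) = compc (tgt Y n) (ghom n.+1);
  ghom_idt : forall n, compc (ghom n.+1) (idt X n) = compc (idt Y n) (ghom n) }.

Lemma globular_hom_eq X Y (f g : globular_hom X Y) :
  (forall n, f n = g n) -> f = g.
Proof.
case: f g => [f f1 f2 f3] [g g1 g2 g3] /= e.
have {}e : f = g by apply: functional_extensionality_dep.
by case: _ / e g1 g2 g3 => g1 g2 g3; congr GlobularHom; exact: Prop_irrelevance.
Qed.

Definition globular_id (X : globular) : globular_hom X X.
Proof.
by exists (fun n => idc (X n)) => n; rewrite comp1c compc1.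
Defined.

Definition globular_comp X Y Z (g : globular_hom Y Z) (f : globular_hom X Y) :
  globular_hom X Z.
Proof.
exists (fun n => compc (g n) (f n)) => n.
- by rewrite -compcA ghom_src compcA ghom_src compcA.
- by rewrite -compcA ghom_tgt compcA ghom_tgt compcA.
- by rewrite -compcA ghom_idt compcA ghom_idt compcA.
Defined.

Definition globular_cat : category.
Proof.
refine (@Category globular globular_hom globular_id globular_comp _ _ _) => *;
  apply: globular_hom_eq => n /=.
- exact: compcA.
- exact: comp1c.
- exact: compc1.
Defined.

(* Iterates of a family of descending (ascending) maps.  The recursion on [k]
   shifts the family [X] by one dimension, so that no transport is needed. *)
Fixpoint descend0 (X : nat -> C) (d : forall n, hom (X n.+1) (X n)) n :
    hom (X n) (X 0%N) :=
  if n is m.+1 then compc (descend0 d m) (d m) else idc (X 0%N).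

Fixpoint ascend0 (X : nat -> C) (u : forall n, hom (X n) (X n.+1)) n :
    hom (X 0%N) (X n) :=
  if n is m.+1 then compc (u m) (ascend0 u m) else idc (X 0%N).

Fixpoint descend (X : nat -> C) (d : forall n, hom (X n.+1) (X n)) k n :
    (k <= n)%N -> hom (X n) (X k) :=
  match k, n return (k <= n)%N -> hom (X n) (X k) with
  | 0%N, _ => fun _ => descend0 d n
  | k.+1, 0%N => fun h => False_rect _ (notF h)
  | k.+1, n.+1 => fun h => @descend (fun m => X m.+1) (fun m => d m.+1) k n h
  end.

Fixpoint ascend (X : nat -> C) (u : forall n, hom (X n) (X n.+1)) k n :
    (k <= n)%N -> hom (X k) (X n) :=
  match k, n return (k <= n)%N -> hom (X k) (X n) with
  | 0%N, _ => fun _ => ascend0 u n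
  | k.+1, 0%N => fun h => False_rect _ (notF h)
  | k.+1, n.+1 => fun h => @ascend (fun m => X m.+1) (fun m => u m.+1) k n h
  end.

Definition srck (X : globular) k n (h : (k <= n)%N) : hom (X n) (X k) :=
  descend (src X) h.
Definition tgtk (X : globular) k n (h : (k <= n)%N) : hom (X n) (X k) :=
  descend (tgt X) h.
Definition idtk (X : globular) k n (h : (k <= n)%N) : hom (X k) (X n) :=
  ascend (idt X) h.

Lemma descend_natural (X Y : nat -> C) (d : forall n, hom (X n.+1) (X n))
    (d' : forall n, hom (Y n.+1) (Y n)) (f : forall n, hom (X n) (Y n)) :
    (forall n, compc (f n) (d n) = compc (d' n) (f n.+1)) ->
  forall k n (h : (k <= n)%N),
    compc (f k) (descend d h) = compc (descend d' h) (f n).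
Proof.
move=> fd k n; elim: k X Y d d' f fd n => [|k IH] X Y d d' f fd [|n] //= h.
- by rewrite comp1c compc1.
- elim: n {h} => [|n IH] /=; first by rewrite !comp1c fd.
  by rewrite compcA IH -compcA fd compcA.
- exact: (IH (fun m => X m.+1) (fun m => Y m.+1) (fun m => d m.+1)
    (fun m => d' m.+1) (fun m => f m.+1)).
Qed.
End Globular.

(** * Algebras *)

Section Algebras.
Variable K : fieldType.

(* [algType K] excludes the zero algebra, hence this record. *)
Record algebra := Algebra {
  alg_sort :> lmodType K;
  amul : alg_sort -> alg_sort -> alg_sort;
  aone : alg_sort;
  amulA : associative amul;
  amul1x : left_id aone amul;
  amulx1 : right_id aone amul;
  amul_linearl : forall y, linear (amul^~ y);
  amul_linearr : forall x, linear (amul x) }.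

Record algebra_hom (A B : algebra) := AlgebraHom {
  ahom :> A -> B;
  ahom_linear : linear ahom;
  ahom1 : ahom (aone A) = aone B;
  ahomM : forall x y, ahom (amul x y) = amul (ahom x) (ahom y) }.

Lemma algebra_hom_eq A B (f g : algebra_hom A B) : f =1 g -> f = g.
Proof.
case: f g => [f f1 f2 f3] [g g1 g2 g3] /= /funext e.
by case: _ / e g1 g2 g3 => g1 g2 g3; congr AlgebraHom; exact: Prop_irrelevance.
Qed.

Definition algebra_id (A : algebra) : algebra_hom A A.
Proof. by exists id. Defined.

Definition algebra_comp A B C (g : algebra_hom B C) (f : algebra_hom A B) :
  algebra_hom A C.
Proof.
exists (g \o f) => [a x y||x y] /=.
- by rewrite !ahom_linear.
- by rewrite !ahom1.
- by rewrite !ahomM.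
Defined.

Definition Alg : category.
Proof.
by refine (@Category algebra algebra_hom algebra_id algebra_comp _ _ _) => *;
  apply: algebra_hom_eq.
Defined.

Section Pullback.
Variables (A B C : algebra) (f : algebra_hom A C) (g : algebra_hom B C).

Definition pullback_pred : {pred A * B} := fun p => f p.1 == g p.2.

Lemma pullback_submod : submod_closed pullback_pred.
Proof.
have h0 (D : algebra) (h : algebra_hom D C) : h 0 = 0.
  by have := ahom_linear h (-1) 0 0; rewrite !scaleN1r !addNr.
split; first by rewrite unfold_in /= !h0.
move=> a p q; rewrite !unfold_in /= => /eqP ep /eqP eq.
by rewrite !ahom_linear ep eq.
Qed.

HB.instance Definition _ :=
  GRing.isSubmodClosed.Build K (A * B)%type pullback_pred pullback_submod.

Record pullback_sort := PullbackSort {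
  pb_val : A * B;
  pb_valP : pb_val \in pullback_pred }.

HB.instance Definition _ := [isSub for pb_val].
HB.instance Definition _ := [Choice of pullback_sort by <:].
HB.instance Definition _ := [SubChoice_isSubLmodule of pullback_sort by <:].

Let pb : lmodType K := pullback_sort.

Lemma pb_eqP (p : pb) : f (pb_val p).1 = g (pb_val p).2.
Proof. by apply/eqP; exact: pb_valP. Qed.

Definition pb_pair x y (e : f x = g y) : pb :=
  @PullbackSort (x, y) (introT eqP e).

Let pb_mul_eq (p q : pb) :
  f (amul (pb_val p).1 (pb_val q).1) = g (amul (pb_val p).2 (pb_val q).2).
Proof. by rewrite !ahomM !pb_eqP. Qed.

Definition pb_mul (p q : pb) : pb := pb_pair (pb_mul_eq p q).

Definition pb_one : pb := pb_pair (etrans (ahom1 f) (esym (ahom1 g))).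

Definition pullback : algebra.
Proof.
exists pb pb_mul pb_one.
- by move=> p q r; apply: val_inj; rewrite /= !amulA.
- by move=> [[x y] h]; apply: val_inj; rewrite /= !amul1x.
- by move=> [[x y] h]; apply: val_inj; rewrite /= !amulx1.
- move=> q a p p'; apply: val_inj.
  by congr pair; exact: amul_linearl.
- move=> q a p p'; apply: val_inj.
  by congr pair; exact: amul_linearr.
Defined.
End Pullback.
End Algebras.

(** * Infinity-categories, infinity-groupoids and globular algebras *)

Section InfinityCategories.
Variable K : fieldType.

(* [pullback (tgtk X _) (srck X _)] is the algebra of pairs [(x, y)] of
   [n]-cells such that [t_k x = s_k y]. *)
Definition compositions (X : globular (Alg K)) :=
  forall k n (h : (k < n)%N),
    algebra_hom (pullback (tgtk X (ltnW h)) (srck X (ltnW h))) (X n).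

Definition star (X : globular (Alg K)) (c : compositions X) k n (h : (k < n)%N)
    (x y : X n) (e : tgtk X (ltnW h) x = srck X (ltnW h) y) : X n :=
  c k n h (pb_pair e).
Arguments star {X} c {k n} h x y e.

(* The composability hypotheses are quantified over in each axiom; those about
   composites are always satisfied, as consequences of the others and of the
   globular relations. *)
Record infcat_axioms (X : globular (Alg K)) (c : compositions X) : Prop := {
  star_src : forall n (h : (n < n.+1)%N) (x y : X n.+1) e,
    src X n (star c h x y e) = src X n x;
  star_tgt : forall n (h : (n < n.+1)%N) (x y : X n.+1) e,
    tgt X n (star c h x y e) = tgt X n y;
  star_srck : forall k n (h : (k < n)%N) (h' : (k < n.+1)%N)
      (x y : X n.+1) e e',
    src X n (star c h' x y e) = star c h (src X n x) (src X n y) e';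
  star_tgtk : forall k n (h : (k < n)%N) (h' : (k < n.+1)%N)
      (x y : X n.+1) e e',
    tgt X n (star c h' x y e) = star c h (tgt X n x) (tgt X n y) e';
  star_idt : forall k n (h : (k < n)%N) (h' : (k < n.+1)%N) (x y : X n) e e',
    idt X n (star c h x y e) = star c h' (idt X n x) (idt X n y) e';
  starA : forall k n (h : (k < n)%N) (x y z : X n) exy eyz exy_z ex_yz,
    star c h (star c h x y exy) z exy_z = star c h x (star c h y z eyz) ex_yz;
  star1x : forall k n (h : (k < n)%N) (x : X n) e,
    star c h (idtk X (ltnW h) (srck X (ltnW h) x)) x e = x;
  starx1 : forall k n (h : (k < n)%N) (x : X n) e,
    star c h x (idtk X (ltnW h) (tgtk X (ltnW h) x)) e = x;
  star_exchange : forall j k n (hj : (j < n)%N) (hk : (k < n)%N)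
      (x x' y y' : X n) exx' eyy' e1 exy ex'y' e2, (j < k)%N ->
    star c hj (star c hk x x' exx') (star c hk y y' eyy') e1 =
    star c hk (star c hj x y exy) (star c hj x' y' ex'y') e2 }.

Record infcat := Infcat {
  infcat_glob :> globular (Alg K);
  infcat_comp : compositions infcat_glob;
  infcatP : infcat_axioms infcat_comp }.

Definition preserves_star (X Y : infcat) (f : globular_hom X Y) : Prop :=
  forall k n (h : (k < n)%N) (x y : X n) e e',
    f n (star (@infcat_comp X) h x y e) =
    star (@infcat_comp Y) h (f n x) (f n y) e'.

Lemma preserves_star1 (X : infcat) : preserves_star (globular_id X).
Proof. by move=> k n h x y e e'; congr star; exact: Prop_irrelevance. Qed.

Lemma ghom_composable (X Y : globular (Alg K)) (f : globular_hom X Y) k n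
    (h : (k <= n)%N) (x y : X n) :
  tgtk X h x = srck X h y -> tgtk Y h (f n x) = srck Y h (f n y).
Proof.
move=> e.
have es := descend_natural (ghom_src f) h.
have et := descend_natural (ghom_tgt f) h.
have /= <- := congr1 (fun u : algebra_hom _ _ => u x) et.
have /= <- := congr1 (fun u : algebra_hom _ _ => u y) es.
by rewrite -[X in ahom (f k) X]/(tgtk X h x) e.
Qed.

Lemma preserves_starM (X Y Z : infcat) (g : globular_hom Y Z)
    (f : globular_hom X Y) :
  preserves_star g -> preserves_star f -> preserves_star (globular_comp g f).
Proof.
move=> gP fP k n h x y e e' /=.
by rewrite (fP _ _ _ _ _ _ (ghom_composable f e)) gP.
Qed.

Definition InfAlg : category :=
  @wide_subcat (@induced_cat (globular_cat (Alg K)) infcat infcat_glob)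
    preserves_star preserves_star1 preserves_starM.

Definition is_infgroupoid (X : infcat) : Prop :=
  forall n (x : X n.+1), exists y : X n.+1,
    [/\ src X n y = tgt X n x, tgt X n y = src X n x,
        exists e, star (@infcat_comp X) (ltnSn n) x y e = idt X n (src X n x)
      & exists e, star (@infcat_comp X) (ltnSn n) y x e = idt X n (tgt X n x)].

Definition InfGpd : category := @full_subcat InfAlg is_infgroupoid.

Definition globalg_rel (A : globular (Alg K)) : Prop :=
  forall n (a b : A n),
    let s0 (x : A n) : A n := idtk A (leq0n n) (srck A (leq0n n) x) in
    let t0 (x : A n) : A n := idtk A (leq0n n) (tgtk A (leq0n n) x) in
    amul a b = amul a (s0 b) + amul (t0 a) b - amul (t0 a) (s0 b) /\
    amul a b = amul (s0 a) b + amul a (t0 b) - amul (s0 a) (t0 b).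

Definition GlobAlgRel : category :=
  @full_subcat (globular_cat (Alg K)) globalg_rel.
End InfinityCategories.

(** * Globular bimodules *)

Section Bimodules.
Variables (K : fieldType) (A : algebra K).

Record bimodule := Bimodule {
  bim_sort :> lmodType K;
  lact : A -> bim_sort -> bim_sort;
  ract : bim_sort -> A -> bim_sort;
  lact_linearl : forall m, linear (lact^~ m);
  lact_linearr : forall a, linear (lact a);
  ract_linearl : forall a, linear (ract^~ a);
  ract_linearr : forall m, linear (ract m);
  lact1 : forall m, lact (aone A) m = m;
  ract1 : forall m, ract m (aone A) = m;
  lactM : forall a b m, lact (amul a b) m = lact a (lact b m);
  ractM : forall m a b, ract m (amul a b) = ract (ract m a) b;
  lract : forall a m b, ract (lact a m) b = lact a (ract m b) }.

Record bimodule_hom (M N : bimodule) := BimoduleHom {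
  bhom :> M -> N;
  bhom_linear : linear bhom;
  bhom_lact : forall a m, bhom (lact a m) = lact a (bhom m);
  bhom_ract : forall m a, bhom (ract m a) = ract (bhom m) a }.

Lemma bimodule_hom_eq M N (f g : bimodule_hom M N) : f =1 g -> f = g.
Proof.
case: f g => [f f1 f2 f3] [g g1 g2 g3] /= /funext e.
by case: _ / e g1 g2 g3 => g1 g2 g3; congr BimoduleHom; exact: Prop_irrelevance.
Qed.

Definition bimodule_id (M : bimodule) : bimodule_hom M M.
Proof. by exists id. Defined.

Definition bimodule_comp M N P (g : bimodule_hom N P) (f : bimodule_hom M N) :
  bimodule_hom M P.
Proof.
exists (g \o f) => [a x y|a m|m a] /=.
- by rewrite !bhom_linear.
- by rewrite !bhom_lact.
- by rewrite !bhom_ract.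
Defined.

Definition Bimod : category.
Proof.
by refine (@Category bimodule bimodule_hom bimodule_id bimodule_comp _ _ _)
  => *; apply: bimodule_hom_eq.
Defined.

Definition regular_bimodule : bimodule.
Proof.
exists A (@amul K A) (@amul K A).
- exact: amul_linearl.
- exact: amul_linearr.
- exact: amul_linearl.
- exact: amul_linearr.
- exact: amul1x.
- exact: amulx1.
- by move=> a b m; rewrite amulA.
- by move=> m a b; rewrite amulA.
- by move=> a m b; rewrite amulA.
Defined.
End Bimodules.

Section GlobularBimodules.
Variable K : fieldType.

Record globimod := Globimod {
  gb_alg : algebra K;
  gb_mod :> globular (Bimod gb_alg) }.

Record globimod_hom (X Y : globimod) := GlobimodHom {
  gbF : algebra_hom (gb_alg X) (gb_alg Y);
  gbG : forall n, X n -> Y n;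
  gbG_linear : forall n, linear (@gbG n);
  gbG_src : forall n (m : X n.+1), gbG (src X n m) = src Y n (gbG m);
  gbG_tgt : forall n (m : X n.+1), gbG (tgt X n m) = tgt Y n (gbG m);
  gbG_idt : forall n (m : X n), gbG (idt X n m) = idt Y n (gbG m);
  gbG_act : forall n (a a' : gb_alg X) (m : X n),
    gbG (ract (lact a m) a') = ract (lact (gbF a) (gbG m)) (gbF a') }.

Lemma globimod_hom_eq X Y (f g : globimod_hom X Y) :
  gbF f =1 gbF g -> (forall n, @gbG _ _ f n =1 @gbG _ _ g n) -> f = g.
Proof.
case: f g => [F G f1 f2 f3 f4 f5] [F' G' g1 g2 g3 g4 g5] /=.
move=> /algebra_hom_eq eF eG; case: _ / eF g5 => g5.
have {}eG : G = G' by apply: functional_extensionality_dep => n; apply/funext.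
case: _ / eG g1 g2 g3 g4 g5 => g1 g2 g3 g4 g5.
by congr GlobimodHom; exact: Prop_irrelevance.
Qed.

Definition globimod_id (X : globimod) : globimod_hom X X.
Proof. by exists (algebra_id _) (fun _ => id). Defined.

Definition globimod_comp X Y Z (g : globimod_hom Y Z) (f : globimod_hom X Y) :
  globimod_hom X Z.
Proof.
exists (algebra_comp (gbF g) (gbF f)) (fun n => @gbG _ _ g n \o @gbG _ _ f n).
- by move=> n a x y /=; rewrite !gbG_linear.
- by move=> n m /=; rewrite !gbG_src.
- by move=> n m /=; rewrite !gbG_tgt.
- by move=> n m /=; rewrite !gbG_idt.
- by move=> n a a' m /=; rewrite !gbG_act.
Defined.

Definition GlobBimod : category.
Proof.
by refine (@Category globimod globimod_hom globimod_id globimod_comp _ _ _)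
  => *; apply: globimod_hom_eq.
Defined.

(* The identification of [M_0] with [A] given by an equality of bimodules. *)
Definition to_base (X : globimod) (e : X 0%N = regular_bimodule (gb_alg X))
    (x : X 0%N) : gb_alg X :=
  eq_rect (X 0%N) (fun M : bimodule (gb_alg X) => M) x _ e.

Definition of_base (X : globimod) (e : X 0%N = regular_bimodule (gb_alg X))
    (a : gb_alg X) : X 0%N :=
  eq_rect (regular_bimodule (gb_alg X)) (fun M : bimodule (gb_alg X) => M) a _
    (esym e).

Definition globimod_rel (X : globimod)
    (e : X 0%N = regular_bimodule (gb_alg X)) : Prop :=
  forall n (a b : X n),
    let s0 (x : X n) : gb_alg X := to_base e (srck X (leq0n n) x) in
    let t0 (x : X n) : gb_alg X := to_base e (tgtk X (leq0n n) x) in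
    let i0 (x : gb_alg X) : X n := idtk X (leq0n n) (of_base e x) in
    ract a (s0 b) + lact (t0 a) b - i0 (amul (t0 a) (s0 b)) =
    lact (s0 a) b + ract a (t0 b) - i0 (amul (s0 a) (t0 b)).

Record based_globimod (X : globimod) : Prop := BasedGlobimod {
  base_eq : X 0%N = regular_bimodule (gb_alg X);
  base_rel : globimod_rel base_eq }.

Let C := @full_subcat GlobBimod based_globimod.

(* Since [M_0] is [A] itself, the two maps [A -> B] carried by a morphism
   [(F, G)], namely [F] and [G_0], are required to agree.  This does not follow
   from [G (a m a') = F a (G m) F a'], which only gives
   [G_0 a = F a * G_0 1]: without it the pair [(id, 0)] would be an
   endomorphism of every [(A, M)], and the category would not be isomorphic to
   that of globular algebras satisfying [globalg_rel]. *)
Definition base_compatible (X Y : C) (f : hom X Y) : Prop :=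
  forall x : sval X 0%N,
    to_base (base_eq (svalP Y)) (@gbG _ _ f 0%N x) =
    gbF f (to_base (base_eq (svalP X)) x).

Lemma base_compatible1 (X : C) : base_compatible (idc X).
Proof. by []. Qed.

Lemma base_compatibleM (X Y Z : C) (g : hom Y Z) (f : hom X Y) :
  base_compatible g -> base_compatible f -> base_compatible (compc g f).
Proof. by move=> gP fP x; rewrite /= gP fP. Qed.

Definition GlobBimodRel : category :=
  @wide_subcat C base_compatible base_compatible1 base_compatibleM.
End GlobularBimodules.

(* Main.v *)
Require Import Defs.
From mathcomp Require Import all_boot all_algebra.
From mathcomp Require Import boolp.
Import Defs.
Set Implicit Arguments.
Unset Strict Implicit.
Unset Printing Implicit Defensive.
Import GRing.Theory.
Local Open Scope ring_scope.

(** Write [i_k], [s_k], [t_k] for the iterated identity, source and target.  The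
    whole theorem rests on one remark: a composable pair [(x, y)], with
    [t_k x = s_k y = c], is the linear combination
    [(x, c) + (c, y) - (c, c)] of pairs whose composites are known from the
    unit laws.  As the composition is linear, it has to be
    [x + y - i_k t_k x] ([starE]).  Thus compositions are a property of a
    globular algebra and not a structure on it, every globular morphism is a
    functor, and [i s x + i t x - x] is an inverse of [x], so that [InfAlg] and
    [InfGpd] coincide.

    It remains to say when the forced formula is multiplicative.  Splitting
    off [c], this means that [ker t_k] and [ker s_k] annihilate each other, in
    both orders.  For [k = 0] this is the relation [globalg_rel], because
    [a - t_0 a] lies in [ker t_0] and [b - s_0 b] in [ker s_0]
    ([infcat_globalg_rel]); and the case [k = 0] gives all the others, since
    [t_0 = t_0 t_k] and [s_0 = s_0 s_k] ([globalg_orthogonal]).  The axioms of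
    infinity-categories are then linear identities ([star_compP]).  This gives
    the isomorphism of [InfAlg] with [GlobAlgRel].

    In [GlobAlgRel] the product is expressed by products in which one factor is
    an iterated identity of a [0]-cell, that is, by the bimodule structure over
    the algebra of [0]-cells.  Conversely, on an object of [GlobBimodRel],
    [a b := a s_0(b) + t_0(a) b - t_0(a) s_0(b)] is an associative product
    ([balg]), compatible with sources, targets and identities, and the relation
    [globimod_rel] is what is missing to get both equalities of [globalg_rel].
    This gives the isomorphism of [GlobAlgRel] with [GlobBimodRel].

    The categories have to be isomorphic and not only equivalent, so that
    objects must be compared by equality.  A functor which is bijective on
    objects and on morphisms is an isomorphism
    ([isomorphic_of_bijections]).  Equalities of objects are reduced to
    equalities of carriers and of operations by the injectivity of maps to
    types of raw data ([raw_of_globalg_inj], [raw_of_globimod_inj]). *)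

(** * Isomorphisms of categories *)

(** Functors can only be compared after their values on objects have been
    identified; this moves a morphism along equalities of its ends. *)
Definition hom_cast (C : category) (X X' Y Y' : C) (eX : X = X') (eY : Y = Y')
    (f : hom X Y) : hom X' Y' :=
  eq_rect Y (hom X') (eq_rect X (fun Z => hom Z Y) f X' eX) Y' eY.

Section HomCast.
Variable C : category.

Lemma hom_cast_loop (X Y : C) (eX : X = X) (eY : Y = Y) (f : hom X Y) :
  hom_cast eX eY f = f.
Proof. by rewrite (Prop_irrelevance eX erefl) (Prop_irrelevance eY erefl). Qed.

Lemma hom_cast_trans (X X' X'' Y Y' Y'' : C) (a : X = X') (a' : X' = X'')
    (b : Y = Y') (b' : Y' = Y'') (f : hom X Y) :
  hom_cast a' b' (hom_cast a b f) = hom_cast (etrans a a') (etrans b b') f.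
Proof. by case: _ / a'; case: _ / b'. Qed.

Lemma hom_cast1 (X X' : C) (e : X = X') : hom_cast e e (idc X) = idc X'.
Proof. by case: _ / e. Qed.

Lemma hom_castM (X X' Y Y' Z Z' : C) (a : X = X') (b : Y = Y') (c : Z = Z')
    (g : hom Y Z) (f : hom X Y) :
  hom_cast a c (compc g f) = compc (hom_cast b c g) (hom_cast a b f).
Proof. by case: _ / a; case: _ / b; case: _ / c. Qed.
End HomCast.

Lemma fhom_cast (C D : category) (F : functor C D) (X X' Y Y' : C)
    (a : X = X') (b : Y = Y') (f : hom X Y) :
  fhom F (hom_cast a b f) =
  hom_cast (congr1 (fobj F) a) (congr1 (fobj F) b) (fhom F f).
Proof. by case: _ / a; case: _ / b. Qed.

Lemma functor_eq (C D : category) (F G : functor C D)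
    (e : forall X, F X = G X) :
  (forall X Y (f : hom X Y), hom_cast (e X) (e Y) (fhom F f) = fhom G f) ->
  F = G.
Proof.
case: F G e => [fo fh f1 fM] [go gh g1 gM] /= e.
have E : fo = go by apply/funext.
case: _ / E gh g1 gM e => gh g1 gM e ef.
have {ef} E : fh = gh.
  apply: functional_extensionality_dep => X.
  apply: functional_extensionality_dep => Y.
  by apply/funext => f; rewrite -ef hom_cast_loop.
by case: _ / E g1 gM => g1 gM; congr Functor; exact: Prop_irrelevance.
Qed.

(** The inverse functor sends [h : hom Y Z] to the unique morphism over the
    transport of [h] to [hom (F (g Y)) (F (g Z))].  All the transports cancel
    because proofs of equality are unique. *)
Lemma isomorphic_of_bijections (C D : category) (F : functor C D) (g : D -> C)
    (k : forall X Y : C, hom (F X) (F Y) -> hom X Y) :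
  cancel (fobj F) g -> cancel g (fobj F) ->
  (forall X Y, cancel (@fhom _ _ F X Y) (@k X Y)) ->
  (forall X Y, cancel (@k X Y) (@fhom _ _ F X Y)) ->
  isomorphic C D.
Proof.
move=> FK gK hK kK.
pose gh Y Z (h : hom Y Z) : hom (g Y) (g Z) :=
  k _ _ (hom_cast (esym (gK Y)) (esym (gK Z)) h).
have gh1 Y : gh Y Y (idc Y) = idc (g Y).
  by rewrite /gh hom_cast1 -fhom1 hK.
have ghM X Y Z (u : hom Y Z) (v : hom X Y) :
    gh _ _ (compc u v) = compc (gh _ _ u) (gh _ _ v).
  apply: (can_inj (@hK _ _)); rewrite fhomM !kK.
  exact: hom_castM.
pose G := Functor gh1 ghM.
exists F, G; split.
- apply: (@functor_eq C C (functor_comp G F) (functor_id C) FK) => X Y f /=.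
  apply: (can_inj (@hK _ _)).
  by rewrite fhom_cast kK hom_cast_trans hom_cast_loop.
- apply: (@functor_eq D D (functor_comp F G) (functor_id D) gK) => X Y f /=.
  by rewrite kK hom_cast_trans hom_cast_loop.
Qed.

Lemma functor_compA (C D E E' : category) (H : functor E E')
    (G : functor D E) (F : functor C D) :
  functor_comp H (functor_comp G F) = functor_comp (functor_comp H G) F.
Proof.
pose HGF := functor_comp H (functor_comp G F).
exact: (@functor_eq _ _ HGF (functor_comp (functor_comp H G) F) (fun=> erefl)).
Qed.

Lemma functor_comp_id1 (C D : category) (F : functor C D) :
  functor_comp F (functor_id C) = F.
Proof.
exact: (@functor_eq _ _ (functor_comp F (functor_id C)) F (fun=> erefl)).
Qed.

Lemma isomorphic_trans (C D E : category) :
  isomorphic C D -> isomorphic D E -> isomorphic C E.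
Proof.
move=> [F [G [GF FG]]] [F' [G' [GF' FG']]].
exists (functor_comp F' F), (functor_comp G G'); split.
  by rewrite functor_compA -(functor_compA G) GF' functor_comp_id1.
by rewrite functor_compA -(functor_compA F') FG functor_comp_id1.
Qed.

(** * Iterated sources, targets and identities *)

Section Iterates.
Variable C : category.

Lemma descend_refl (X : nat -> C) (d : forall n, hom (X n.+1) (X n)) k
    (h : (k <= k)%N) : descend d h = idc (X k).
Proof.
elim: k X d h => [|k IH] X d h //=.
exact: (IH (fun m => X m.+1) (fun m => d m.+1)).
Qed.

Lemma ascend_refl (X : nat -> C) (u : forall n, hom (X n) (X n.+1)) k
    (h : (k <= k)%N) : ascend u h = idc (X k).
Proof.
elim: k X u h => [|k IH] X u h //=.
exact: (IH (fun m => X m.+1) (fun m => u m.+1)).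
Qed.

(** [descend] recurses on [k], that is, from the bottom of the tower; this and
    [ascendS] give access to its top, where the globular relations apply. *)
Lemma descendS (X : nat -> C) (d : forall n, hom (X n.+1) (X n)) k n
    (h : (k <= n)%N) (h' : (k <= n.+1)%N) :
  descend d h' = compc (descend d h) (d n).
Proof.
elim: k X d n h h' => [|k IH] X d [|n] //= h h'.
exact: (IH (fun m => X m.+1) (fun m => d m.+1)).
Qed.

Lemma ascendS (X : nat -> C) (u : forall n, hom (X n) (X n.+1)) k n
    (h : (k <= n)%N) (h' : (k <= n.+1)%N) :
  ascend u h' = compc (u n) (ascend u h).
Proof.
elim: k X u n h h' => [|k IH] X u [|n] //= h h'.
exact: (IH (fun m => X m.+1) (fun m => u m.+1)).
Qed.

(** Induction on the distance between two dimensions, for families depending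
    on the proof that they are ordered. *)
Lemma leq_dim_ind (P : forall k n, (k <= n)%N -> Prop) :
  (forall k (h : (k <= k)%N), P k k h) ->
  (forall k n (h : (k <= n)%N) (h' : (k <= n.+1)%N), P k n h -> P k n.+1 h') ->
  forall k n (h : (k <= n)%N), P k n h.
Proof.
move=> P0 PS k; elim=> [|n IH] h; first by case: k h => [|k] h.
have [hk|nk] := leqP k n; first exact: PS (IH hk).
have e : n.+1 = k by apply/eqP; rewrite eqn_leq h nk.
by case: _ / e h {nk} IH => h _.
Qed.

Lemma descend_trans (X : nat -> C) (d : forall n, hom (X n.+1) (X n)) j k n
    (hjk : (j <= k)%N) (hkn : (k <= n)%N) (hjn : (j <= n)%N) :
  compc (descend d hjk) (descend d hkn) = descend d hjn.
Proof.
elim/leq_dim_ind: k n / hkn hjk hjn => [k h|k n h h' IH] hjk hjn.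
  by rewrite descend_refl compc1 (bool_irrelevance hjk hjn).
rewrite (descendS d h) (descendS d (leq_trans hjk h)) compcA.
by rewrite (IH _ (leq_trans hjk h)).
Qed.

Lemma ascend_trans (X : nat -> C) (u : forall n, hom (X n) (X n.+1)) j k n
    (hjk : (j <= k)%N) (hkn : (k <= n)%N) (hjn : (j <= n)%N) :
  compc (ascend u hkn) (ascend u hjk) = ascend u hjn.
Proof.
elim/leq_dim_ind: k n / hkn hjk hjn => [k h|k n h h' IH] hjk hjn.
  by rewrite ascend_refl comp1c (bool_irrelevance hjk hjn).
rewrite (ascendS u h) (ascendS u (leq_trans hjk h)) -compcA.
by rewrite (IH _ (leq_trans hjk h)).
Qed.

Lemma descend_ascend (X : nat -> C) (d : forall n, hom (X n.+1) (X n))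
    (u : forall n, hom (X n) (X n.+1)) :
  (forall n, compc (d n) (u n) = idc (X n)) ->
  forall k n (h h' : (k <= n)%N),
    compc (descend d h) (ascend u h') = idc (X k).
Proof.
move=> du k n h; elim/leq_dim_ind: k n / h => [k h|k n h h' IH] h''.
  by rewrite descend_refl ascend_refl comp1c.
rewrite (descendS d h) (ascendS u h) -compcA (compcA (d n)) du comp1c.
exact: IH.
Qed.

Lemma ascend_natural (X Y : nat -> C) (u : forall n, hom (X n) (X n.+1))
    (u' : forall n, hom (Y n) (Y n.+1)) (f : forall n, hom (X n) (Y n)) :
    (forall n, compc (f n.+1) (u n) = compc (u' n) (f n)) ->
  forall k n (h : (k <= n)%N),
    compc (f n) (ascend u h) = compc (ascend u' h) (f k).
Proof.
move=> fu k n h; elim/leq_dim_ind: k n / h => [k h|k n h h' IH].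
  by rewrite !ascend_refl compc1 comp1c.
by rewrite !(ascendS _ h) compcA fu -!compcA IH.
Qed.

Variable X : globular C.

(** [s_k s = s_k t] in dimension greater than [k.+1]: the last step of [s_k]
    is [s], and [s s = s t]. *)
Lemma srck_tgt k n (h : (k < n)%N) :
  compc (srck X (ltnW h)) (tgt X n) = compc (srck X (ltnW h)) (src X n).
Proof.
case: n h => // n h.
by rewrite /srck (descendS (src X) (h : (k <= n)%N)) -!compcA globular_ss.
Qed.

Lemma tgtk_src k n (h : (k < n)%N) :
  compc (tgtk X (ltnW h)) (src X n) = compc (tgtk X (ltnW h)) (tgt X n).
Proof.
case: n h => // n h.
by rewrite /tgtk (descendS (tgt X) (h : (k <= n)%N)) -!compcA globular_ts.
Qed.
End Iterates.

(** * Linear identities in a globular algebra *)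

Section LinearMaps.
Variables (K : fieldType) (U V : lmodType K) (f : U -> V).
Hypothesis fL : linear f.

Lemma linD x y : f (x + y) = f x + f y.
Proof. by rewrite -[x]scale1r fL !scale1r. Qed.

Lemma linB x y : f (x - y) = f x - f y.
Proof. by rewrite addrC -scaleN1r fL scaleN1r addrC. Qed.

Lemma lin0 : f 0 = 0.
Proof. by rewrite -(subrr 0) linB subrr. Qed.
End LinearMaps.

Section AlgebraLemmas.
Variables (K : fieldType).
Implicit Types A B : algebra K.

Definition ahomD A B (f : algebra_hom A B) := linD (ahom_linear f).
Definition ahomB A B (f : algebra_hom A B) := linB (ahom_linear f).
Definition ahom0 A B (f : algebra_hom A B) := lin0 (ahom_linear f).

Lemma amulDl A (x y z : A) : amul (x + y) z = amul x z + amul y z.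
Proof. exact: (linD (amul_linearl z)). Qed.
Lemma amulDr A (x y z : A) : amul x (y + z) = amul x y + amul x z.
Proof. exact: (linD (amul_linearr x)). Qed.
Lemma amulBl A (x y z : A) : amul (x - y) z = amul x z - amul y z.
Proof. exact: (linB (amul_linearl z)). Qed.
Lemma amulBr A (x y z : A) : amul x (y - z) = amul x y - amul x z.
Proof. exact: (linB (amul_linearr x)). Qed.
Lemma amulx0 A (x : A) : amul x 0 = 0.
Proof. exact: (lin0 (amul_linearr x)). Qed.
Lemma amul0x A (x : A) : amul 0 x = 0.
Proof. exact: (lin0 (amul_linearl x)). Qed.

(** How the vanishing of products of elements of [ker t_0] and [ker s_0] turns
    into [globalg_rel]. *)
Lemma amul_eq_of_orthogonal A (a a' b b' : A) :
  amul (a - a') (b - b') = 0 ->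
  amul a b = amul a b' + amul a' b - amul a' b'.
Proof.
rewrite !(amulBl, amulBr) => /eqP; rewrite !subr_eq add0r => /eqP ->.
by rewrite addrC addrA.
Qed.

Lemma congr_ahom (A B : Alg K) (f g : hom A B) (x : A : algebra K) :
  f = g -> f x = g x.
Proof. by move=> ->. Qed.

Variable X : globular (Alg K).

Lemma src_idt n (x : X n) : src X n (idt X n x) = x.
Proof. exact: (congr_ahom x (globular_si X n)). Qed.
Lemma tgt_idt n (x : X n) : tgt X n (idt X n x) = x.
Proof. exact: (congr_ahom x (globular_ti X n)). Qed.

Lemma srckS k n (h : (k <= n)%N) (h' : (k <= n.+1)%N) x :
  srck X h' x = srck X h (src X n x).
Proof. by rewrite /srck (descendS _ h). Qed.
Lemma tgtkS k n (h : (k <= n)%N) (h' : (k <= n.+1)%N) x :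
  tgtk X h' x = tgtk X h (tgt X n x).
Proof. by rewrite /tgtk (descendS _ h). Qed.
Lemma idtkS k n (h : (k <= n)%N) (h' : (k <= n.+1)%N) x :
  idtk X h' x = idt X n (idtk X h x).
Proof. by rewrite /idtk (ascendS _ h). Qed.

Lemma srck_id n (h : (n <= n)%N) x : srck X h x = x.
Proof. by rewrite /srck descend_refl. Qed.
Lemma tgtk_id n (h : (n <= n)%N) x : tgtk X h x = x.
Proof. by rewrite /tgtk descend_refl. Qed.
Lemma idtk_id n (h : (n <= n)%N) x : idtk X h x = x.
Proof. by rewrite /idtk ascend_refl. Qed.

Lemma srck1 n (h : (n <= n.+1)%N) x : srck X h x = src X n x.
Proof. by rewrite (srckS (leqnn n)) srck_id. Qed.
Lemma tgtk1 n (h : (n <= n.+1)%N) x : tgtk X h x = tgt X n x.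
Proof. by rewrite (tgtkS (leqnn n)) tgtk_id. Qed.
Lemma idtk1 n (h : (n <= n.+1)%N) x : idtk X h x = idt X n x.
Proof. by rewrite (idtkS (leqnn n)) idtk_id. Qed.

Lemma srck_srck j k n (hjk : (j <= k)%N) (hkn : (k <= n)%N)
    (hjn : (j <= n)%N) x :
  srck X hjk (srck X hkn x) = srck X hjn x.
Proof. exact: (congr_ahom x (descend_trans (src X) hjk hkn hjn)). Qed.
Lemma tgtk_tgtk j k n (hjk : (j <= k)%N) (hkn : (k <= n)%N)
    (hjn : (j <= n)%N) x :
  tgtk X hjk (tgtk X hkn x) = tgtk X hjn x.
Proof. exact: (congr_ahom x (descend_trans (tgt X) hjk hkn hjn)). Qed.
Lemma idtk_idtk j k n (hjk : (j <= k)%N) (hkn : (k <= n)%N)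
    (hjn : (j <= n)%N) x :
  idtk X hkn (idtk X hjk x) = idtk X hjn x.
Proof. exact: (congr_ahom x (ascend_trans (idt X) hjk hkn hjn)). Qed.

Lemma srck_idtk k n (h h' : (k <= n)%N) x : srck X h (idtk X h' x) = x.
Proof. exact: (congr_ahom x (descend_ascend (globular_si X) h h')). Qed.
Lemma tgtk_idtk k n (h h' : (k <= n)%N) x : tgtk X h (idtk X h' x) = x.
Proof. exact: (congr_ahom x (descend_ascend (globular_ti X) h h')). Qed.

Lemma tgtk_srcE k n (h : (k < n)%N) x :
  tgtk X (ltnW h) (src X n x) = tgtk X (ltnW h) (tgt X n x).
Proof. exact: (congr_ahom x (tgtk_src X h)). Qed.

End AlgebraLemmas.

(** * Compositions are forced *)

Section StarFormula.
Variables (K : fieldType) (X : globular (Alg K)).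

Section Forced.
Variables (c : compositions X) (cP : infcat_axioms c).

(** Linearity applied to [(x, y) = (x, c) + ((c, y) - (c, c))] where
    [c = t_k x = s_k y], the composites of these three pairs being given by the
    unit laws. *)
Lemma starE k n (h : (k < n)%N) (x y : X n)
    (e : tgtk X (ltnW h) x = srck X (ltnW h) y) :
  star c e = x + y - idtk X (ltnW h) (tgtk X (ltnW h) x).
Proof.
set i := ahom (idtk X (ltnW h)); set t := ahom (tgtk X (ltnW h)).
set s := ahom (srck X (ltnW h)).
have e1 : t x = s (i (t x)) by rewrite /s srck_idtk.
have e2 : t (i (s y)) = s y by rewrite /t tgtk_idtk.
have e3 : t (i (t x)) = s (i (t x)) by rewrite /t tgtk_idtk.
have E : pb_pair e = pb_pair e1 + (pb_pair e2 - pb_pair e3).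
  apply: val_inj; rewrite /=.
  congr (_, _); rewrite /=.
    by rewrite -[s y]e subrr addr0.
  by rewrite addrC subrK.
rewrite /star E ahomD ahomB.
rewrite (_ : @c _ _ h (pb_pair e1) = x); last exact: (starx1 cP).
rewrite (_ : @c _ _ h (pb_pair e2) = y); last exact: (star1x cP).
rewrite (_ : @c _ _ h (pb_pair e3) = i (t x)) ?addrA //.
have e4 : t (i (t x)) = s (i (t (i (t x)))).
  by rewrite /t /s tgtk_idtk srck_idtk.
rewrite -[RHS](starx1 cP e4) /star; congr (@c _ _ h _); apply: val_inj.
by congr (_, _); rewrite -/t e3 /s srck_idtk.
Qed.

(** Both [(u, 0)] and [(0, v)] are composable, with composites [u] and [v],
    and their product is zero in either order; the composition along [0]-cells
    is multiplicative. *)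
Lemma infcat_orthogonal n (u v : X n.+1) :
  tgtk X (leq0n n.+1) u = 0 -> srck X (leq0n n.+1) v = 0 ->
  amul u v = 0 /\ amul v u = 0.
Proof.
have h : (0 < n.+1)%N by [].
rewrite (bool_irrelevance (leq0n _) (ltnW h)) => tu sv.
have e1 : tgtk X (ltnW h) u = srck X (ltnW h) 0 by rewrite tu ahom0.
have e2 : tgtk X (ltnW h) 0 = srck X (ltnW h) v by rewrite sv ahom0.
have cu : @c _ _ h (pb_pair e1) = u.
  by rewrite [LHS](starE e1) tu ahom0 subr0 addr0.
have cv : @c _ _ h (pb_pair e2) = v.
  by rewrite [LHS](starE e2) !ahom0 subr0 add0r.
split.
  rewrite -{1}cu -{1}cv -ahomM -[RHS](ahom0 (@c _ _ h)); congr (@c _ _ _ _).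
  by apply: val_inj; rewrite /= amulx0 amul0x.
rewrite -{1}cu -{1}cv -ahomM -[RHS](ahom0 (@c _ _ h)); congr (@c _ _ _ _).
by apply: val_inj; rewrite /= amulx0 amul0x.
Qed.

(** In positive dimension [a - t_0 a] and [b - s_0 b] are orthogonal, which
    gives the first equality, and so are [b - t_0 b] and [a - s_0 a], which
    gives the second.  In dimension [0] both read [a b = a b + a b - a b]. *)
Lemma infcat_globalg_rel : globalg_rel X.
Proof.
case=> [|n] a b; first by split; rewrite /= addrK.
have o x y := @infcat_orthogonal n
  (x - idtk X (leq0n n.+1) (tgtk X (leq0n n.+1) x))
  (y - idtk X (leq0n n.+1) (srck X (leq0n n.+1) y)).
have {}o x y := o x y (ltac:(by rewrite ahomB tgtk_idtk subrr))
  (ltac:(by rewrite ahomB srck_idtk subrr)).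
split; first exact: amul_eq_of_orthogonal (o a b).1.
rewrite [X in _ = X - _]addrC.
exact: amul_eq_of_orthogonal (o b a).2.
Qed.
End Forced.
End StarFormula.

(** * From the relation to compositions *)

Section StarConstruction.
Variables (K : fieldType) (X : globular (Alg K)) (XP : globalg_rel X).

(** The relation involves [s_0] and [t_0] only.  These factor through [s_k]
    and [t_k], so that [t_0 u = 0] and [s_0 v = 0], and all the terms on its
    right-hand side vanish: the first form gives [u v = 0] and the second one
    [v u = 0]. *)
Lemma globalg_orthogonal k n (h : (k <= n)%N) (u v : X n) :
  tgtk X h u = 0 -> srck X h v = 0 -> amul u v = 0 /\ amul v u = 0.
Proof.
move=> tu sv; have [+ _] := XP u v; have [_ +] := XP v u.
have t0 : tgtk X (leq0n n) u = 0.
  by rewrite -(tgtk_tgtk (leq0n k) h) tu ahom0.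
have s0 : srck X (leq0n n) v = 0.
  by rewrite -(srck_srck (leq0n k) h) sv ahom0.
by rewrite t0 s0 !ahom0 !amulx0 !amul0x !(addr0, subr0, add0r).
Qed.

Section Star.
Variables (k n : nat) (h : (k < n)%N).
Let i := ahom (idtk X (ltnW h)).
Let t := ahom (tgtk X (ltnW h)).
Let PB := pullback (tgtk X (ltnW h)) (srck X (ltnW h)).

Definition star_fun (p : PB) : X n :=
  (pb_val p).1 + (pb_val p).2 - i (t (pb_val p).1).

Lemma star_fun_linear : linear star_fun.
Proof.
move=> a [[x y] /= hp] [[x' y'] /= hq]; rewrite /star_fun /=.
rewrite /i /t !ahom_linear !scalerDr scalerN.
by rewrite opprD !addrA [LHS](ACl (1*3*5*2*4*6)).
Qed.

Lemma star_fun1 : star_fun (aone PB) = aone (X n).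
Proof. by rewrite /star_fun /= /i /t !ahom1 addrK. Qed.

(** Write the composites as [(x - c) + y] and [(x' - c') + y'].  In their
    product, orthogonality replaces [y'] by [c'] next to [x - c], and [y] by
    [c] next to [x' - c']; what is left is [x x' - c c' + y y']. *)
Lemma star_funM p q : star_fun (amul p q) = amul (star_fun p) (star_fun q).
Proof.
case: p q => [[x y] /= hp] [[x' y'] /= hq].
have e := eqP hp; have e' := eqP hq; rewrite /= in e e'.
rewrite /star_fun /= -/t /i /t.
set c := idtk X _ (tgtk X _ x); set c' := idtk X _ (tgtk X _ x').
have tu : tgtk X (ltnW h) (x - c) = 0 by rewrite ahomB tgtk_idtk subrr.
have tu' : tgtk X (ltnW h) (x' - c') = 0 by rewrite ahomB tgtk_idtk subrr.
have sv : srck X (ltnW h) (y - c) = 0 by rewrite ahomB /c srck_idtk e subrr.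
have sv' : srck X (ltnW h) (y' - c') = 0.
  by rewrite ahomB /c' srck_idtk e' subrr.
have [o1 _] := globalg_orthogonal tu sv'.
have [_ o2] := globalg_orthogonal tu' sv.
have {}o1 : amul (x - c) y' = amul (x - c) c'.
  by apply/eqP; rewrite -subr_eq0 -amulBr o1.
have {}o2 : amul y (x' - c') = amul c (x' - c').
  by apply/eqP; rewrite -subr_eq0 -amulBl o2.
rewrite !ahomM -/c -/c' ![_ + _ - _]addrAC.
rewrite amulDl (amulDr (x - c)) (amulDr y) o1 o2.
by rewrite -amulDr subrK addrA amulBl amulBr addrA subrK.
Qed.

Definition star_hom : algebra_hom PB (X n) :=
  AlgebraHom star_fun_linear star_fun1 star_funM.
End Star.

Definition star_comp : compositions X := star_hom.

Lemma star_compE k n (h : (k < n)%N) (x y : X n)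
    (e : tgtk X (ltnW h) x = srck X (ltnW h) y) :
  star star_comp e = x + y - idtk X (ltnW h) (tgtk X (ltnW h) x).
Proof. by []. Qed.

(** With the explicit formula, all the axioms are consequences of the globular
    relations between iterated maps; exchange also uses that
    [i_j t_j] and [i_k t_k] compose to [i_j t_j] in both orders. *)
Lemma star_compP : infcat_axioms star_comp.
Proof.
split.
- move=> n h x y e; rewrite star_compE !ahomB !ahomD.
  by rewrite idtk1 src_idt e srck1 addrK.
- move=> n h x y e; rewrite star_compE !ahomB !ahomD.
  by rewrite idtk1 tgt_idt tgtk1 addrAC subrr add0r.
- move=> k n h h' x y e e'; rewrite !star_compE !ahomB !ahomD.
  by rewrite (idtkS (ltnW h)) src_idt (tgtkS (ltnW h)) tgtk_srcE.
- move=> k n h h' x y e e'; rewrite !star_compE !ahomB !ahomD.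
  by rewrite (idtkS (ltnW h)) tgt_idt (tgtkS (ltnW h)).
- move=> k n h h' x y e e'; rewrite !star_compE !ahomB !ahomD.
  by rewrite (idtkS (ltnW h)) (tgtkS (ltnW h)) tgt_idt.
- move=> k n h x y z exy eyz exy_z ex_yz; rewrite !star_compE !ahomB !ahomD.
  rewrite tgtk_idtk [_ + idtk X _ (tgtk X _ y)]addrC addrK !addrA.
  by rewrite [LHS](ACl (1*2*4*5*3)).
- by move=> k n h x e; rewrite star_compE tgtk_idtk addrAC subrr add0r.
- by move=> k n h x e; rewrite star_compE addrK.
- move=> j k n hj hk x x' y y' exx' eyy' e1 exy ex'y' e2 hjk.
  rewrite !star_compE !ahomB !ahomD.
  have ji z : tgtk X (ltnW hj) (idtk X (ltnW hk) z) = tgtk X (ltnW hjk) z.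
    by rewrite -(tgtk_tgtk (ltnW hjk) (ltnW hk)) tgtk_idtk.
  have ik z : tgtk X (ltnW hk) (idtk X (ltnW hj) z) = idtk X (ltnW hjk) z.
    by rewrite -(idtk_idtk (ltnW hjk) (ltnW hk)) tgtk_idtk.
  rewrite ji ik (tgtk_tgtk _ _ (ltnW hj)) (idtk_idtk _ _ (ltnW hj)).
  rewrite !opprD !opprK !addrA.
  by rewrite [LHS](ACl (1*4*7*2*5*8*3*6*9)).
Qed.
End StarConstruction.

(** * Infinity-algebras, infinity-groupoids and globular algebras *)

Section InfinityAlgebras.
Variable K : fieldType.

Lemma ghom_idtk (X Y : globular (Alg K)) (f : globular_hom X Y) k n
    (h : (k <= n)%N) (x : X k) : f n (idtk X h x) = idtk Y h (f k x).
Proof.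
exact: congr_ahom x (ascend_natural (ghom_idt f) h).
Qed.

Lemma ghom_tgtk (X Y : globular (Alg K)) (f : globular_hom X Y) k n
    (h : (k <= n)%N) (x : X n) : f k (tgtk X h x) = tgtk Y h (f n x).
Proof.
exact: congr_ahom x (descend_natural (ghom_tgt f) h).
Qed.

(** The forced formula only involves the linear and the globular structure. *)
Lemma preserves_star_ghom (X Y : infcat K) (f : globular_hom X Y) :
  preserves_star f.
Proof.
move=> k n h x y e e'.
rewrite (starE (infcatP X)) (starE (infcatP Y)) ahomB ahomD.
by congr (_ + _ - _); rewrite ghom_idtk ghom_tgtk.
Qed.

(** The inverse is the reflection [i s x + i t x - x] of [x]. *)
Lemma infgroupoid (X : infcat K) : is_infgroupoid X.
Proof.
move=> n x; pose i := ahom (idt X n).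
pose y := i (src X n x) + i (tgt X n x) - x.
have sy : src X n y = tgt X n x.
  by rewrite ahomB ahomD !src_idt [_ + tgt X n x]addrC addrK.
have ty : tgt X n y = src X n x by rewrite ahomB ahomD !tgt_idt addrK.
have exy : tgtk X (ltnW (ltnSn n)) x = srck X (ltnW (ltnSn n)) y.
  by rewrite tgtk1 srck1.
have eyx : tgtk X (ltnW (ltnSn n)) y = srck X (ltnW (ltnSn n)) x.
  by rewrite tgtk1 srck1.
exists y; split=> //; [exists exy|exists eyx].
  rewrite (starE (infcatP X)) tgtk1 idtk1 /y -/i.
  by rewrite [x + _]addrC addrNK addrK.
rewrite (starE (infcatP X)) tgtk1 idtk1 ty /y -/i.
by rewrite addrNK addrAC subrr add0r.
Qed.

Lemma compositions_eq (X : globular (Alg K)) (c c' : compositions X) :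
  infcat_axioms c -> infcat_axioms c' -> c = c'.
Proof.
move=> cP c'P.
apply: functional_extensionality_dep => k.
apply: functional_extensionality_dep => n.
apply: functional_extensionality_dep => h.
apply: algebra_hom_eq => p.
have -> : p = pb_pair (pb_eqP p) by apply: val_inj; case: p => [[x y] hp].
by rewrite -[LHS]/(star c (pb_eqP p)) -[RHS]/(star c' (pb_eqP p)) !starE.
Qed.

Lemma infcat_eq (X Y : infcat K) : infcat_glob X = infcat_glob Y -> X = Y.
Proof.
case: X Y => [X c cP] [Y c' c'P] /= e; case: _ / e c' c'P => c' c'P.
have e := compositions_eq cP c'P; case: _ / e c'P => c'P; congr Infcat.
exact: Prop_irrelevance.
Qed.

Definition to_infgpd_obj (X : InfAlg K) : InfGpd K :=
  exist _ X (@infgroupoid X).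

Definition to_infgpd : functor (InfAlg K) (InfGpd K) :=
  @Functor (InfAlg K) (InfGpd K) to_infgpd_obj (fun _ _ f => f)
    (fun _ => erefl) (fun _ _ _ _ _ => erefl).

Lemma InfAlg_isomorphic_InfGpd : isomorphic (InfAlg K) (InfGpd K).
Proof.
apply: (@isomorphic_of_bijections _ _ to_infgpd (@sval _ _)
  (fun _ _ f => f)) => //.
by case=> X XP; exact: eq_exist.
Qed.

Definition to_globalg : functor (InfAlg K) (GlobAlgRel K) :=
  @Functor (InfAlg K) (GlobAlgRel K)
    (fun X => exist _ (infcat_glob X) (infcat_globalg_rel (infcatP X)))
    (fun _ _ f => sval f) (fun _ => erefl) (fun _ _ _ _ _ => erefl).

Definition of_globalg_obj (X : GlobAlgRel K) : InfAlg K :=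
  Infcat (star_compP (svalP X)).

Definition of_globalg_hom (X Y : InfAlg K)
    (f : hom (to_globalg X) (to_globalg Y)) : hom X Y :=
  exist (@preserves_star K X Y) f (@preserves_star_ghom X Y f).

Lemma InfAlg_isomorphic_GlobAlgRel : isomorphic (InfAlg K) (GlobAlgRel K).
Proof.
apply: (@isomorphic_of_bijections _ _ to_globalg of_globalg_obj of_globalg_hom).
- by move=> X; exact: infcat_eq.
- by case=> X XP; exact: eq_exist.
- by move=> X Y f; exact: whom_eq.
- by [].
Qed.

End InfinityAlgebras.

(** * The product on a globular bimodule *)

Section BimoduleLemmas.
Variables (K : fieldType) (A : algebra K).
Implicit Types M N : bimodule A.

Definition bhomD M N (f : bimodule_hom M N) := linD (bhom_linear f).
Definition bhomB M N (f : bimodule_hom M N) := linB (bhom_linear f).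

Lemma lactBr M (a : A) (m n : M) : lact a (m - n) = lact a m - lact a n.
Proof. exact: (linB (lact_linearr a)). Qed.
Lemma lactDr M (a : A) (m n : M) : lact a (m + n) = lact a m + lact a n.
Proof. exact: (linD (lact_linearr a)). Qed.
Lemma ractBl M (a : A) (m n : M) : ract (m - n) a = ract m a - ract n a.
Proof. exact: (linB (ract_linearl a)). Qed.
Lemma ractDl M (a : A) (m n : M) : ract (m + n) a = ract m a + ract n a.
Proof. exact: (linD (ract_linearl a)). Qed.
Lemma congr_bhom (M N : Bimod A) (f g : hom M N) (x : M : bimodule A) :
  f = g -> f x = g x.
Proof. by move=> ->. Qed.

(** The identification of [M_0] with the regular bimodule, seen as a morphism
    of bimodules, so that its compatibility with all the operations comes for
    free. *)
Definition bim_cast M N (e : M = N) : bimodule_hom M N :=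
  eq_rect M (bimodule_hom M) (bimodule_id M) N e.

Lemma bim_castE M N (e : M = N) (x : M) :
  bim_cast e x = eq_rect M (fun P : bimodule A => P) x N e.
Proof. by case: _ / e. Qed.

Lemma bim_castK M N (e : M = N) (e' : N = M) :
  cancel (bim_cast e) (bim_cast e').
Proof. by case: _ / e e' => e' x; rewrite (Prop_irrelevance e' erefl). Qed.
End BimoduleLemmas.

Section AlgebraOfBimodule.
Variables (K : fieldType) (X : globimod K).
Local Notation A := (gb_alg X).
Variable e : X 0%N = regular_bimodule A.

(** [bsrc], [btgt] and [bidt] are [s_0], [t_0] and the iterated identity, with
    [0]-cells read in the base algebra. *)
Definition bsrc n : bimodule_hom (X n) (regular_bimodule A) :=
  bimodule_comp (bim_cast e) (srck X (leq0n n)).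
Definition btgt n : bimodule_hom (X n) (regular_bimodule A) :=
  bimodule_comp (bim_cast e) (tgtk X (leq0n n)).
Definition bidt n : bimodule_hom (regular_bimodule A) (X n) :=
  bimodule_comp (idtk X (leq0n n)) (bim_cast (esym e)).

Lemma bsrcE n x : bsrc n x = to_base e (srck X (leq0n n) x).
Proof. exact: bim_castE. Qed.
Lemma btgtE n x : btgt n x = to_base e (tgtk X (leq0n n) x).
Proof. exact: bim_castE. Qed.
Lemma bidtE n a : bidt n a = idtk X (leq0n n) (of_base e a).
Proof. by rewrite /bidt /= bim_castE. Qed.

Lemma bsrc_bidt n (a : A) : bsrc n (bidt n a) = a.
Proof.
have E x : srck X (leq0n n) (idtk X (leq0n n) x) = x.
  exact: (congr_bhom x (descend_ascend (globular_si X) _ _)).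
by rewrite /bsrc /bidt /= E bim_castK.
Qed.
Lemma btgt_bidt n (a : A) : btgt n (bidt n a) = a.
Proof.
have E x : tgtk X (leq0n n) (idtk X (leq0n n) x) = x.
  exact: (congr_bhom x (descend_ascend (globular_ti X) _ _)).
by rewrite /btgt /bidt /= E bim_castK.
Qed.

Lemma bsrc_src n x : bsrc n (src X n x) = bsrc n.+1 x.
Proof. by []. Qed.
Lemma btgt_tgt n x : btgt n (tgt X n x) = btgt n.+1 x.
Proof. by []. Qed.
Lemma bsrc_tgt n x : bsrc n.+1 (tgt X n.+1 x) = bsrc n.+2 x.
Proof.
by congr (bim_cast e _); exact: (congr_bhom x (srck_tgt X (ltn0Sn n))).
Qed.
Lemma btgt_src n x : btgt n.+1 (src X n.+1 x) = btgt n.+2 x.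
Proof.
by congr (bim_cast e _); exact: (congr_bhom x (tgtk_src X (ltn0Sn n))).
Qed.
Lemma src_idtb n x : src X n (idt X n x) = x.
Proof. exact: (congr_bhom x (globular_si X n)). Qed.
Lemma tgt_idtb n x : tgt X n (idt X n x) = x.
Proof. exact: (congr_bhom x (globular_ti X n)). Qed.
Lemma bsrc_idt n x : bsrc n.+1 (idt X n x) = bsrc n x.
Proof. by rewrite -bsrc_src src_idtb. Qed.
Lemma btgt_idt n x : btgt n.+1 (idt X n x) = btgt n x.
Proof. by rewrite -btgt_tgt tgt_idtb. Qed.
Lemma idt_bidt n a : idt X n (bidt n a) = bidt n.+1 a.
Proof. by []. Qed.
Lemma src_bidt n a : src X n (bidt n.+1 a) = bidt n a.
Proof. by rewrite -idt_bidt src_idtb. Qed.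
Lemma tgt_bidt n a : tgt X n (bidt n.+1 a) = bidt n a.
Proof. by rewrite -idt_bidt tgt_idtb. Qed.
Lemma bidt0 x : bidt 0 (bsrc 0 x) = x.
Proof. exact: bim_castK. Qed.

Lemma bsrc_lact n a x : bsrc n (lact a x) = amul a (bsrc n x).
Proof. exact: (bhom_lact (bsrc n)). Qed.
Lemma btgt_lact n a x : btgt n (lact a x) = amul a (btgt n x).
Proof. exact: (bhom_lact (btgt n)). Qed.
Lemma bidt_lact n a x : lact a (bidt n x) = bidt n (amul a x).
Proof. exact/esym/(bhom_lact (bidt n)). Qed.
Lemma bsrc_ract n a x : bsrc n (ract x a) = amul (bsrc n x) a.
Proof. exact: (bhom_ract (bsrc n)). Qed.
Lemma btgt_ract n a x : btgt n (ract x a) = amul (btgt n x) a.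
Proof. exact: (bhom_ract (btgt n)). Qed.
Lemma bidt_ract n a x : ract (bidt n x) a = bidt n (amul x a).
Proof. exact/esym/(bhom_ract (bidt n)). Qed.

(** The only product for which the first equality of [globalg_rel] can hold. *)
Definition bmul n (a b : X n) : X n :=
  ract a (bsrc n b) + lact (btgt n a) b - bidt n (amul (btgt n a) (bsrc n b)).

Lemma bsrc_bmul n a b : bsrc n (bmul a b) = amul (bsrc n a) (bsrc n b).
Proof. by rewrite bhomB bhomD bsrc_bidt bsrc_lact bsrc_ract addrK. Qed.
Lemma btgt_bmul n a b : btgt n (bmul a b) = amul (btgt n a) (btgt n b).
Proof.
by rewrite bhomB bhomD btgt_bidt btgt_lact btgt_ract addrAC subrr add0r.
Qed.

(** Since [s_0] and [t_0] are multiplicative for [bmul], both sides expand to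
    [a s_0(b) s_0(c) + t_0(a) b s_0(c) + t_0(a) t_0(b) c] minus
    [t_0(a) s_0(b) s_0(c)] and [t_0(a) t_0(b) s_0(c)]. *)
Lemma bmulA n : associative (@bmul n).
Proof.
move=> a b c; rewrite {1 3}/bmul bsrc_bmul btgt_bmul /bmul.
rewrite !(ractBl, lactBr) !(ractDl, lactDr) -!ractM -!lactM bidt_lact bidt_ract.
rewrite !amulA lract !addrA.
by rewrite [LHS](ACl (1*2*5*3*4)).
Qed.

Lemma bmul_bidtl n a x : bmul (bidt n a) x = lact a x.
Proof. by rewrite /bmul btgt_bidt bidt_ract addrAC subrr add0r. Qed.
Lemma bmul_bidtr n a x : bmul x (bidt n a) = ract x a.
Proof. by rewrite /bmul bsrc_bidt bidt_lact addrK. Qed.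

Definition bone n : X n := bidt n (aone A).

Lemma bmul1x n : left_id (bone n) (@bmul n).
Proof. by move=> x; rewrite bmul_bidtl lact1. Qed.
Lemma bmulx1 n : right_id (bone n) (@bmul n).
Proof. by move=> x; rewrite bmul_bidtr ract1. Qed.

Lemma bmul_linearl n y : linear ((@bmul n)^~ y).
Proof.
move=> a x x'; rewrite /bmul bhom_linear ract_linearl lact_linearl.
rewrite amul_linearl bhom_linear !scalerDr scalerN opprD !addrA.
by rewrite [LHS](ACl (1*3*5*2*4*6)).
Qed.
Lemma bmul_linearr n x : linear (@bmul n x).
Proof.
move=> a y y'; rewrite /bmul bhom_linear ract_linearr lact_linearr.
rewrite amul_linearr bhom_linear !scalerDr scalerN opprD !addrA.
by rewrite [LHS](ACl (1*3*5*2*4*6)).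
Qed.

Definition balg n : algebra K :=
  Algebra (@bmulA n) (@bmul1x n) (@bmulx1 n)
    (@bmul_linearl n) (@bmul_linearr n).

Lemma bmul0 (a b : X 0%N) : bmul a b = bidt 0 (amul (bsrc 0 a) (bsrc 0 b)).
Proof. by rewrite -{1}[a]bidt0 bmul_bidtl -{1}[b]bidt0 bidt_lact. Qed.

(** From dimension [2] on, [s] preserves [s_0] and [t_0].  From dimension [1]
    to [0] it does not preserve [t_0], but there the product is that of the base
    algebra, and the last two terms of [bmul] have the same source. *)
Lemma src_bmul n (a b : X n.+1) :
  src X n (bmul a b) = bmul (src X n a) (src X n b).
Proof.
rewrite {1}/bmul bhomB bhomD bhom_lact bhom_ract src_bidt.
case: n a b => [|n] a b; last by rewrite /bmul btgt_src.
rewrite bmul0 -[src X 0 b in LHS]bidt0 bidt_lact addrK.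
by rewrite -[src X 0 a in LHS]bidt0 bidt_ract.
Qed.
Lemma tgt_bmul n (a b : X n.+1) :
  tgt X n (bmul a b) = bmul (tgt X n a) (tgt X n b).
Proof.
rewrite {1}/bmul bhomB bhomD bhom_lact bhom_ract tgt_bidt.
case: n a b => [|n] a b; last by rewrite /bmul bsrc_tgt.
rewrite bmul0 -[tgt X 0 a in LHS]bidt0 bidt_ract addrAC subrr add0r.
by rewrite -[tgt X 0 b in LHS]bidt0 bidt_lact.
Qed.
Lemma idt_bmul n (a b : X n) :
  idt X n (bmul a b) = bmul (idt X n a) (idt X n b).
Proof.
by rewrite /bmul bhomB bhomD bhom_lact bhom_ract bsrc_idt btgt_idt.
Qed.

Definition globalg_of : globular (Alg K).
Proof.
pose s n : algebra_hom (balg n.+1) (balg n) :=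
  @AlgebraHom _ (balg n.+1) (balg n) (src X n)
    (bhom_linear _) (src_bidt _ _) (@src_bmul n).
pose t n : algebra_hom (balg n.+1) (balg n) :=
  @AlgebraHom _ (balg n.+1) (balg n) (tgt X n)
    (bhom_linear _) (tgt_bidt _ _) (@tgt_bmul n).
pose i n : algebra_hom (balg n) (balg n.+1) :=
  @AlgebraHom _ (balg n) (balg n.+1) (idt X n)
    (bhom_linear _) (erefl _) (@idt_bmul n).
apply: (@Globular (Alg K) balg s t i) => n; apply: algebra_hom_eq => x /=.
- exact: (congr_bhom x (globular_ss X n)).
- exact: (congr_bhom x (globular_ts X n)).
- exact: src_idtb.
- exact: tgt_idtb.
Defined.

Lemma srck_globalg_of n x :
  srck globalg_of (leq0n n) x = srck X (leq0n n) x :> X 0%N.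
Proof.
by rewrite /srck /=; elim: n x => [|n IH] x //=; exact: IH.
Qed.
Lemma tgtk_globalg_of n x :
  tgtk globalg_of (leq0n n) x = tgtk X (leq0n n) x :> X 0%N.
Proof.
by rewrite /tgtk /=; elim: n x => [|n IH] x //=; exact: IH.
Qed.
Lemma idtk_globalg_of n x :
  idtk globalg_of (leq0n n) x = idtk X (leq0n n) x :> X n.
Proof.
by rewrite /idtk /=; elim: n x => [|n IH] x //=; rewrite IH.
Qed.

Hypothesis eP : globimod_rel e.

(** The first equality holds by definition of the product, and [globimod_rel]
    turns it into the second one. *)
Lemma globalg_of_rel : globalg_rel globalg_of.
Proof.
move=> n a b s0 t0.
have sE x : s0 x = bidt n (bsrc n x).
  by rewrite /s0 srck_globalg_of idtk_globalg_of /bidt /bsrc /= bim_castK.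
have tE x : t0 x = bidt n (btgt n x).
  by rewrite /t0 tgtk_globalg_of idtk_globalg_of /bidt /btgt /= bim_castK.
rewrite -![amul _ _]/(bmul _ _) !sE !tE !bmul_bidtl !bmul_bidtr !bidt_lact.
split=> //; rewrite /bmul !bsrcE !btgtE !bidtE; exact: eP.
Qed.
End AlgebraOfBimodule.

(** * Equality of structures through raw data *)

Lemma existT_inj (T : Type) (P : T -> Type) (x : T) (y z : P x) :
  existT P x y = existT P x z -> y = z.
Proof.
move=> e; have := projT2_eq e.
by rewrite (Prop_irrelevance (projT1_eq e) erefl).
Qed.

Section RawGlobular.
Variables (C : category) (R : Type) (sort : R -> Type) (raw_obj : C -> R).
Variable fn : forall X Y, hom X Y -> sort (raw_obj X) -> sort (raw_obj Y).
Hypothesis raw_obj_inj : injective raw_obj.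
Hypothesis fn_inj : forall X Y, injective (@fn X Y).

Definition raw_maps (c : nat -> R) : Type :=
  ((forall n, sort (c n.+1) -> sort (c n)) *
   (forall n, sort (c n.+1) -> sort (c n)) *
   (forall n, sort (c n) -> sort (c n.+1)))%type.

Definition raw_of_globular (X : globular C) : {c : nat -> R & raw_maps c} :=
  existT raw_maps (fun n => raw_obj (X n))
    (fun n => fn (src X n), fun n => fn (tgt X n), fun n => fn (idt X n)).

(** Equality of globular objects over a category whose objects and morphisms
    are determined by raw data [raw_obj] and [fn], without laws. *)
Lemma raw_of_globular_inj : injective raw_of_globular.
Proof.
case=> [c s t i p1 p2 p3 p4] [c' s' t' i' p1' p2' p3' p4'] e.
have ec : c = c'.
  apply/funext => n; apply: raw_obj_inj.
  exact: (congr1 (fun u : {c & raw_maps c} => tag u n) e).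
case: _ / ec s' t' i' p1' p2' p3' p4' e => s' t' i' p1' p2' p3' p4'.
move=> e'; have em := existT_inj e'; clear e'.
have es : s = s'.
  apply: functional_extensionality_dep => n.
  by apply: fn_inj; exact: (congr1 (fun u : raw_maps _ => u.1.1 n) em).
have et : t = t'.
  apply: functional_extensionality_dep => n.
  by apply: fn_inj; exact: (congr1 (fun u : raw_maps _ => u.1.2 n) em).
have ei : i = i'.
  apply: functional_extensionality_dep => n.
  by apply: fn_inj; exact: (congr1 (fun u : raw_maps _ => u.2 n) em).
subst t' s' i'; congr Globular; exact: Prop_irrelevance.
Qed.
End RawGlobular.

Section RawAlgebra.
Variable K : fieldType.

Definition raw_algebra : Type := {L : lmodType K & ((L -> L -> L) * L)%type}.
Definition raw_of_algebra (A : algebra K) : raw_algebra :=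
  existT (fun L : lmodType K => ((L -> L -> L) * L)%type) A (@amul K A, aone A).

Lemma raw_of_algebra_inj : injective raw_of_algebra.
Proof.
case=> [L m o p1 p2 p3 p4 p5] [L' m' o' q1 q2 q3 q4 q5] e.
have eL : L = L' := congr1 (@tag _ _) e.
case: _ / eL m' o' q1 q2 q3 q4 q5 e => m' o' q1 q2 q3 q4 q5.
move=> e'; case: (existT_inj e') => em eo {e'}.
case: _ / em q1 q2 q3 q4 q5 => q1 q2 q3 q4 q5.
case: _ / eo q2 q3 => q2 q3.
by congr Algebra; exact: Prop_irrelevance.
Qed.

Definition raw_bimodule (A : Type) : Type :=
  {L : lmodType K & ((A -> L -> L) * (L -> A -> L))%type}.
Definition raw_of_bimodule (A : algebra K) (M : bimodule A) : raw_bimodule A :=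
  existT (fun L : lmodType K => ((A -> L -> L) * (L -> A -> L))%type) M
    (@lact K A M, @ract K A M).

Lemma raw_of_bimodule_inj A : injective (@raw_of_bimodule A).
Proof.
case=> [L l r p1 p2 p3 p4 p5 p6 p7 p8 p9].
case=> [L' l' r' q1 q2 q3 q4 q5 q6 q7 q8 q9] e.
have eL : L = L' := congr1 (@tag _ _) e.
case: _ / eL l' r' q1 q2 q3 q4 q5 q6 q7 q8 q9 e.
move=> l' r' q1 q2 q3 q4 q5 q6 q7 q8 q9.
move=> e'; case: (existT_inj e') => el er {e'}.
case: _ / el q1 q2 q3 q4 q5 q6 q7 q8 q9 => q1 q2 q3 q4 q5 q6 q7 q8 q9.
case: _ / er q3 q4 q6 q8 q9 => q3 q4 q6 q8 q9.
by congr Bimodule; exact: Prop_irrelevance.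
Qed.
End RawAlgebra.

Section GlobimodObjects.
Variable K : fieldType.
Local Notation lmod := (lmodType K).

Definition raw_glob_algebra : Type :=
  {c : nat -> raw_algebra K &
    raw_maps (fun r : raw_algebra K => tag r : Type) c}.

Definition raw_of_globalg (X : globular (Alg K)) : raw_glob_algebra :=
  @raw_of_globular (Alg K) (raw_algebra K) (fun r => tag r) (@raw_of_algebra K)
    (fun A B (f : algebra_hom A B) => f : A -> B) X.

Lemma raw_of_globalg_inj : injective raw_of_globalg.
Proof.
apply: raw_of_globular_inj; first exact: raw_of_algebra_inj.
by move=> A B f g fg; apply: algebra_hom_eq => x; rewrite fg.
Qed.

Definition raw_globimod : Type :=
  {r : raw_algebra K & {c : nat -> raw_bimodule K (tag r) &
     raw_maps (fun s : raw_bimodule K (tag r) => tag s : Type) c}}.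

Definition raw_of_globimod (X : globimod K) : raw_globimod :=
  existT (fun r : raw_algebra K => {c : nat -> raw_bimodule K (tag r) &
     raw_maps (fun s : raw_bimodule K (tag r) => tag s : Type) c})
   (raw_of_algebra (gb_alg X))
   (@raw_of_globular (Bimod (gb_alg X)) (raw_bimodule K (gb_alg X))
     (fun r => tag r)
     (@raw_of_bimodule K (gb_alg X))
     (fun M N (f : bimodule_hom M N) => f : M -> N) (gb_mod X)).

Lemma raw_of_globimod_inj : injective raw_of_globimod.
Proof.
case=> A M [A' M'] e.
have eA : A = A' by apply: raw_of_algebra_inj; exact: (congr1 (@tag _ _) e).
case: _ / eA M' e => M' e; congr Globimod.
have {}e := existT_inj e; apply: raw_of_globular_inj e.
  exact: raw_of_bimodule_inj.
by move=> P Q f g fg; apply: bimodule_hom_eq => x; rewrite fg.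
Qed.

(** The raw data of a globular bimodule, with the base algebra kept separate
    from the cells so that it can be replaced by an equal one. *)
Definition pack_raw_globimod (A : lmod) (mul : A -> A -> A) (one : A)
    (L : nat -> lmod)
    (la : forall n, A -> L n -> L n) (ra : forall n, L n -> A -> L n)
    (maps : (forall n, L n.+1 -> L n) * (forall n, L n.+1 -> L n) *
       (forall n, L n -> L n.+1)) : raw_globimod :=
  existT (fun r : raw_algebra K => {c : nat -> raw_bimodule K (tag r) &
     raw_maps (fun s : raw_bimodule K (tag r) => tag s : Type) c})
   (existT (fun L : lmod => ((L -> L -> L) * L)%type) A (mul, one))
   (existT (raw_maps (fun s : raw_bimodule K A => tag s : Type))
     (fun n => existT (fun L : lmod => ((A -> L -> L) * (L -> A -> L))%type)
        (L n) (la n, ra n)) maps).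

Definition lcast (A B : lmod) (e : A = B) (x : A) : B :=
  eq_rect A (fun V : lmod => V) x B e.

(** Transport of the base along an equality of vector spaces: this is how
    [M_0] is exchanged with the algebra it is equal to. *)
Lemma pack_raw_globimod_cast (A B : lmod) (e : A = B) mul mul' one one'
    (L : nat -> lmod) la la' ra ra' maps :
  (forall a b, lcast e (mul a b) = mul' (lcast e a) (lcast e b)) ->
  lcast e one = one' ->
  (forall n a m, la n a m = la' n (lcast e a) m) ->
  (forall n a m, ra n m a = ra' n m (lcast e a)) ->
  @pack_raw_globimod A mul one L la ra maps =
  @pack_raw_globimod B mul' one' L la' ra' maps.
Proof.
case: _ / e mul' one' la' ra' => mul' one' la' ra' /= em eo el er.
have -> : mul = mul' by apply/funext => a; apply/funext => b.
have -> : la = la'.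
  by apply: functional_extensionality_dep => n; do 2!apply/funext => ?.
have -> : ra = ra'.
  by apply: functional_extensionality_dep => n; do 2!apply/funext => ?.
by rewrite -eo.
Qed.

Lemma lcast_bim (A : algebra K) (M N : bimodule A) (e : M = N) (x : M) :
  lcast (congr1 (@bim_sort K A) e) x = bim_cast e x.
Proof. by case: _ / e. Qed.

(** * The globular bimodule of a globular algebra *)

Section BimoduleOfAlgebra.
Variable A : globular (Alg K).
Local Notation A0 := (A 0%N : algebra K).
Let i n : A0 -> A n := idtk A (leq0n n).

Let ilinear n : linear (i n). Proof. exact: ahom_linear. Qed.
Let i1 n : i n (aone A0) = aone (A n). Proof. exact: ahom1. Qed.
Let iM n a b : i n (amul a b) = amul (i n a) (i n b). Proof. exact: ahomM. Qed.

Definition cell_bimodule (n : nat) : bimodule A0.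
Proof.
exists (A n) (fun a m => amul (i n a) m) (fun m a => amul m (i n a)).
- by move=> m a x y; rewrite ilinear amul_linearl.
- by move=> a; exact: amul_linearr.
- by move=> a; exact: amul_linearl.
- by move=> m a x y; rewrite ilinear amul_linearr.
- by move=> m; rewrite i1 amul1x.
- by move=> m; rewrite i1 amulx1.
- by move=> a b m; rewrite iM amulA.
- by move=> m a b; rewrite iM amulA.
- by move=> a m b; rewrite amulA.
Defined.

Lemma src_i n a : src A n (i n.+1 a) = i n a.
Proof. exact: src_idt. Qed.
Lemma tgt_i n a : tgt A n (i n.+1 a) = i n a.
Proof. exact: tgt_idt. Qed.

Definition cell_src n : bimodule_hom (cell_bimodule n.+1) (cell_bimodule n).
Proof.
exists (ahom (src A n)).
- exact: ahom_linear.
- by move=> a m; rewrite [LHS]ahomM src_i.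
- by move=> m a; rewrite [LHS]ahomM src_i.
Defined.
Definition cell_tgt n : bimodule_hom (cell_bimodule n.+1) (cell_bimodule n).
Proof.
exists (ahom (tgt A n)).
- exact: ahom_linear.
- by move=> a m; rewrite [LHS]ahomM tgt_i.
- by move=> m a; rewrite [LHS]ahomM tgt_i.
Defined.
Definition cell_idt n : bimodule_hom (cell_bimodule n) (cell_bimodule n.+1).
Proof.
exists (ahom (idt A n)).
- exact: ahom_linear.
- by move=> a m; rewrite [LHS]ahomM.
- by move=> m a; rewrite [LHS]ahomM.
Defined.

Definition globimod_of : globimod K.
Proof.
apply: (@Globimod K A0).
apply: (@Globular (Bimod A0) cell_bimodule cell_src cell_tgt cell_idt) => n;
  apply: bimodule_hom_eq => x /=.
- exact: (congr_ahom x (globular_ss A n)).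
- exact: (congr_ahom x (globular_ts A n)).
- exact: src_idt.
- exact: tgt_idt.
Defined.

Lemma srck_globimod_of n x :
  srck globimod_of (leq0n n) x = srck A (leq0n n) x :> A0.
Proof. by rewrite /srck /=; elim: n x => [|n IH] x //=; exact: IH. Qed.
Lemma tgtk_globimod_of n x :
  tgtk globimod_of (leq0n n) x = tgtk A (leq0n n) x :> A0.
Proof. by rewrite /tgtk /=; elim: n x => [|n IH] x //=; exact: IH. Qed.
Lemma idtk_globimod_of n x :
  idtk globimod_of (leq0n n) x = idtk A (leq0n n) x :> A n.
Proof. by rewrite /idtk /=; elim: n x => [|n IH] x //=; rewrite IH. Qed.

(** The iterated identity in dimension [0] is the identity, so that both
    bimodules have the same underlying data. *)
Lemma globimod_of_base : globimod_of 0%N = regular_bimodule A0.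
Proof. exact: raw_of_bimodule_inj. Qed.

(** An equality between two bimodules which differ only by proofs identifies
    their elements in the obvious way. *)
Lemma bim_cast_same (B : algebra K) (L : lmod) la ra
  p1 p2 p3 p4 p5 p6 p7 p8 p9 q1 q2 q3 q4 q5 q6 q7 q8 q9
  (e : @Bimodule K B L la ra p1 p2 p3 p4 p5 p6 p7 p8 p9 =
       @Bimodule K B L la ra q1 q2 q3 q4 q5 q6 q7 q8 q9) (x : L) :
  bim_cast e x = x.
Proof.
move: e; rewrite (Prop_irrelevance q1 p1) (Prop_irrelevance q2 p2).
rewrite (Prop_irrelevance q3 p3) (Prop_irrelevance q4 p4).
rewrite (Prop_irrelevance q5 p5) (Prop_irrelevance q6 p6).
rewrite (Prop_irrelevance q7 p7) (Prop_irrelevance q8 p8).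
rewrite (Prop_irrelevance q9 p9) => e.
by rewrite (Prop_irrelevance e erefl).
Qed.

Lemma to_base_globimod_of (e : globimod_of 0%N = regular_bimodule A0) x :
  to_base e x = x.
Proof. by rewrite /to_base -bim_castE; exact: bim_cast_same. Qed.

Lemma of_base_globimod_of (e : globimod_of 0%N = regular_bimodule A0) x :
  of_base e x = x.
Proof. by rewrite /of_base -bim_castE; exact: bim_cast_same. Qed.
End BimoduleOfAlgebra.

Lemma globimod_of_rel (A : globular (Alg K)) :
  globalg_rel A -> based_globimod (globimod_of A).
Proof.
move=> AP; exists (globimod_of_base A) => n a b s0 t0 i0.
have sE x : s0 x = srck A (leq0n n) x.
  by rewrite /s0 to_base_globimod_of srck_globimod_of.
have tE x : t0 x = tgtk A (leq0n n) x.
  by rewrite /t0 to_base_globimod_of tgtk_globimod_of.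
have iE x : i0 x = idtk A (leq0n n) x.
  by rewrite /i0 of_base_globimod_of idtk_globimod_of.
rewrite !iE !sE !tE !ahomM.
by case: (AP n a b) => /= e1 e2; rewrite -[LHS]e1 -[RHS]e2.
Qed.

(** The product rebuilt from the bimodule structure is the original one, by
    the first equality of the relation. *)
Lemma globalg_ofK (A : globular (Alg K))
    (e : globimod_of A 0%N = regular_bimodule (A 0%N)) :
  globalg_rel A -> @globalg_of K (globimod_of A) e = A.
Proof.
move=> AP; apply: raw_of_globalg_inj.
have bmulE : (fun n => @bmul K (globimod_of A) e n) = (fun n => @amul K (A n)).
  apply: functional_extensionality_dep => n; do 2![apply/funext => ?].
  rewrite /bmul bsrcE btgtE bidtE !to_base_globimod_of of_base_globimod_of.
  rewrite srck_globimod_of tgtk_globimod_of idtk_globimod_of ahomM.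
  exact: esym (AP _ _ _).1.
have boneE : (fun n => @bone K (globimod_of A) e n) = (fun n => aone (A n)).
  apply: functional_extensionality_dep => n.
  by rewrite /bone bidtE of_base_globimod_of idtk_globimod_of ahom1.
exact: (congr2 (fun m o => existT (raw_maps _)
   (fun n => existT (fun L : lmod => ((L -> L -> L) * L)%type) (A n) (m n, o n))
   (fun n => src A n : _ -> _, fun n => tgt A n : _ -> _,
    fun n => idt A n : _ -> _)) bmulE boneE).
Qed.

(** The algebra of [0]-cells of [globalg_of e] is a copy of the base algebra
    with carrier [M_0]; it is identified with the base algebra along [e]. *)
Lemma globimod_ofK (X : globimod K) (e : X 0%N = regular_bimodule (gb_alg X)) :
  globimod_of (globalg_of e) = X.
Proof.
apply: raw_of_globimod_inj; pose e' := congr1 (@bim_sort K (gb_alg X)) e.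
apply: (@pack_raw_globimod_cast _ _ e') => [a b||n a m|n a m];
  rewrite /e' !lcast_bim.
- exact: (bsrc_bmul e (n := 0) a b).
- exact: (bsrc_bidt e 0).
- rewrite /= idtk_globalg_of.
  rewrite -(bmul_bidtl e); congr (bmul _ _ _).
  by rewrite /bidt /= bim_castK.
- rewrite /= idtk_globalg_of.
  rewrite -(bmul_bidtr e); congr (bmul _ _ _).
  by rewrite /bidt /= bim_castK.
Qed.
End GlobimodObjects.

(** * Globular algebras and globular bimodules *)

Section GlobularBimodules.
Variable K : fieldType.

Definition to_globimod_obj (A : GlobAlgRel K) : GlobBimodRel K :=
  exist _ (globimod_of (sval A)) (globimod_of_rel (svalP A)).

Definition globimod_hom_of (A B : globular (Alg K)) (f : globular_hom A B) :
  globimod_hom (globimod_of A) (globimod_of B).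
Proof.
exists (f 0%N) (fun n => ahom (f n)).
- by move=> n; exact: ahom_linear.
- by move=> n; exact: (fun m => congr_ahom m (ghom_src f n)).
- by move=> n; exact: (fun m => congr_ahom m (ghom_tgt f n)).
- by move=> n; exact: (fun m => congr_ahom m (ghom_idt f n)).
- by move=> n a a' m; rewrite /= !ahomM !ghom_idtk.
Defined.

Lemma globimod_hom_of_id (A : globular (Alg K)) :
  globimod_hom_of (globular_id A) = globimod_id (globimod_of A).
Proof. by apply: globimod_hom_eq => [x|n x]. Qed.

Lemma globimod_hom_of_comp (A B C : globular (Alg K)) (g : globular_hom B C)
    (f : globular_hom A B) :
  globimod_hom_of (globular_comp g f) =
  globimod_comp (globimod_hom_of g) (globimod_hom_of f).
Proof. by apply: globimod_hom_eq => [x|n x]. Qed.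

Lemma globimod_hom_of_compatible (A B : GlobAlgRel K)
    (f : globular_hom (sval A) (sval B)) :
  @base_compatible K (to_globimod_obj A) (to_globimod_obj B)
    (globimod_hom_of f).
Proof. by move=> x; rewrite !to_base_globimod_of. Qed.

Definition to_globimod_hom (A B : GlobAlgRel K) (f : hom A B) :
    hom (to_globimod_obj A) (to_globimod_obj B) :=
  exist _ _ (@globimod_hom_of_compatible A B f).

Lemma to_globimod_hom1 (A : GlobAlgRel K) :
  to_globimod_hom (idc A) = idc (to_globimod_obj A).
Proof. by apply: whom_eq; exact: globimod_hom_of_id. Qed.

Lemma to_globimod_homM (A B C : GlobAlgRel K) (g : hom B C) (f : hom A B) :
  to_globimod_hom (compc g f) =
  compc (to_globimod_hom g) (to_globimod_hom f).
Proof.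
apply: whom_eq.
exact: (@globimod_hom_of_comp (sval A) (sval B) (sval C) g f).
Qed.

Definition to_globimod : functor (GlobAlgRel K) (GlobBimodRel K) :=
  Functor to_globimod_hom1 to_globimod_homM.

Definition of_globimod_obj (X : GlobBimodRel K) : GlobAlgRel K :=
  exist _ (globalg_of (base_eq (svalP X)))
    (globalg_of_rel (base_rel (svalP X))).

(** A compatible morphism [(F, G)] of globular bimodules consists of algebra
    morphisms: [G_n] commutes with [s_0], [t_0] and the action, hence with the
    product, which these determine; it preserves units, which are iterated
    identities of the unit of the base, thanks to [G_0 = F]. *)
Section Full.
Variables (A B : globular (Alg K)) (AP : globalg_rel A) (BP : globalg_rel B).
Variable f : globimod_hom (globimod_of A) (globimod_of B).
Let G (n : nat) : A n -> B n := @gbG _ _ _ f n.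
Let F : algebra_hom (A 0%N) (B 0%N) := gbF f.
Hypothesis G0 : forall x, @G 0 x = F x.

Let Gsrc n x : @G n (src A n x) = src B n (@G n.+1 x).
Proof. exact: (gbG_src f). Qed.
Let Gtgt n x : @G n (tgt A n x) = tgt B n (@G n.+1 x).
Proof. exact: (gbG_tgt f). Qed.
Let Gidt n x : @G n.+1 (idt A n x) = idt B n (@G n x).
Proof. exact: (gbG_idt f). Qed.

Let Gidtk n a : @G n (idtk A (leq0n n) a) = idtk B (leq0n n) (F a).
Proof. by rewrite -G0 /idtk /=; elim: n => [|n IH] //=; rewrite -IH Gidt. Qed.
Let Gsrck n x : srck B (leq0n n) (@G n x) = F (srck A (leq0n n) x).
Proof.
by rewrite -G0 /srck /=; elim: n x => [|n IH] x //=; rewrite -IH Gsrc.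
Qed.
Let Gtgtk n x : tgtk B (leq0n n) (@G n x) = F (tgtk A (leq0n n) x).
Proof.
by rewrite -G0 /tgtk /=; elim: n x => [|n IH] x //=; rewrite -IH Gtgt.
Qed.

Let Glact n a m :
  @G n (amul (idtk A (leq0n n) a) m) = amul (idtk B (leq0n n) (F a)) (@G n m).
Proof.
by have := gbG_act f a (aone _) m; rewrite !ahom1 !ract1.
Qed.
Let Gract n a m :
  @G n (amul m (idtk A (leq0n n) a)) = amul (@G n m) (idtk B (leq0n n) (F a)).
Proof.
by have := gbG_act f (aone _) a m; rewrite !ahom1 !lact1.
Qed.

Let Glin n : linear (@G n). Proof. exact: (@gbG_linear _ _ _ f n). Qed.

Let G1 n : @G n (aone (A n)) = aone (B n).
Proof. by rewrite -(ahom1 (idtk A (leq0n n))) Gidtk !ahom1. Qed.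

Let GM n x y : @G n (amul x y) = amul (@G n x) (@G n y).
Proof.
rewrite (AP x y).1 (BP (@G n x) (@G n y)).1.
by rewrite (linB (@Glin n)) (linD (@Glin n)) Gract !Glact Gidtk !Gsrck !Gtgtk.
Qed.

Definition globular_hom_of : globular_hom A B.
Proof.
pose g n : algebra_hom (A n) (B n) := AlgebraHom (@Glin n) (@G1 n) (@GM n).
by apply: (@GlobularHom _ A B g) => n; apply: algebra_hom_eq => x /=.
Defined.

Lemma globular_hom_ofK : globimod_hom_of globular_hom_of = f.
Proof. by apply: globimod_hom_eq => [x|n x] /=; rewrite -?G0. Qed.
End Full.

Lemma base_compatibleE (A B : GlobAlgRel K)
    (f : hom (to_globimod_obj A) (to_globimod_obj B)) (x : sval A 0%N) :
  @gbG _ _ _ (sval f) 0 x = gbF (sval f) x.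
Proof. by have := svalP f x; rewrite !to_base_globimod_of. Qed.

Definition of_globimod_hom (A B : GlobAlgRel K)
    (f : hom (to_globimod_obj A) (to_globimod_obj B)) : hom A B :=
  globular_hom_of (svalP A) (svalP B) (base_compatibleE f).

Lemma to_of_globimod_hom (A B : GlobAlgRel K)
    (f : hom (to_globimod_obj A) (to_globimod_obj B)) :
  to_globimod_hom (of_globimod_hom f) = f.
Proof. by apply: whom_eq; exact: globular_hom_ofK. Qed.

Lemma GlobAlgRel_isomorphic_GlobBimodRel :
  isomorphic (GlobAlgRel K) (GlobBimodRel K).
Proof.
apply: (@isomorphic_of_bijections _ _ to_globimod of_globimod_obj
  of_globimod_hom).
- by case=> A AP; apply: eq_exist; exact: globalg_ofK.
- by case=> X XP; apply: eq_exist; exact: globimod_ofK.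
- by move=> A B f; apply: globular_hom_eq => n; apply: algebra_hom_eq.
- exact: to_of_globimod_hom.
Qed.
End GlobularBimodules.

Theorem theorem1p3p3 (K : fieldType) :
  isomorphic (InfAlg K) (InfGpd K) /\
  isomorphic (InfAlg K) (GlobAlgRel K) /\
  isomorphic (InfAlg K) (GlobBimodRel K).
Proof.
split; first exact: InfAlg_isomorphic_InfGpd.
split; first exact: InfAlg_isomorphic_GlobAlgRel.
apply: isomorphic_trans (InfAlg_isomorphic_GlobAlgRel K) _.
exact: GlobAlgRel_isomorphic_GlobBimodRel.
Qed.
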